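(* Let $\mathcal X,\mathcal Y$ be infinite-dimensional complex Hilbert spaces, let $p,q\in[1,\infty]$ be conjugate, and let $C\in\mathcal B^p(\mathcal X,\mathcal Y)$, $T\in\mathcal B^q(\mathcal Y,\mathcal X)$. Then $$\sup_{U\in\mathcal U(\mathcal X),\,V\in\mathcal U(\mathcal Y)}|\operatorname{tr}(CUTV)|=\sum_{j=1}^\infty s_j(C)s_j(T).$$ In particular, $\overline{S_C(T)}=K_r(0)$ with $r:=\sum_{j=1}^\infty s_j(C)s_j(T)$.
   Context: $\mathcal U(\mathcal X)$ denotes the set of unitary operators on $\mathcal X$. The exponents $p,q\in[1,\infty]$ are conjugate if $\frac1p+\frac1q=1$ (with $\frac1\infty=0$). Every compact operator $C:\mathcal X\to\mathcal Y$ has a Schmidt decomposition $C=\sum_{n=1}^\infty s_n(C)\langle f_n,\cdot\rangle g_n$ (convergent in operator norm) with orthonormal systems $(f_n)_{n\in\mathbb N}$ in $\mathcal X$ and $(g_n)_{n\in\mathbb N}$ in $\mathcal Y$ and a uniquely determined decreasing null sequence $(s_n(C))_{n\in\mathbb N}$ in $[0,\infty)$, the singular numbers of $C$. Scalar products are conjugate linear in the first argument. For $p\in[1,\infty)$, the Schatten class $\mathcal B^p(\mathcal X,\mathcal Y)$ is the set of compact $C:\mathcal X\to\mathcal Y$ with $\sum_n s_n(C)^p<\infty$; $\mathcal B^\infty(\mathcal X,\mathcal Y)$ is the set of all compact operators $\mathcal X\to\mathcal Y$. For $C\in\mathcal B^p(\mathcal X,\mathcal Y)$, $T\in\mathcal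 B^q(\mathcal Y,\mathcal X)$ with $p,q$ conjugate, $CUTV$ is trace class on $\mathcal Y$ for all $U\in\mathcal U(\mathcal X)$, $V\in\mathcal U(\mathcal Y)$, and $$S_C(T):=\{\operatorname{tr}(CUTV)\mid U\in\mathcal U(\mathcal X),\ V\in\mathcal U(\mathcal Y)\}\subset\mathbb C.$$ $K_r(0)=\{z\in\mathbb C: |z|\le r\}$ is the closed disk, and $\overline{S}$ denotes the closure of $S\subset\mathbb C$. *)

(* Defs.v *)
From HB Require Import structures.
From mathcomp Require Import all_boot all_order all_algebra.
From mathcomp Require Import finmap complex.
From mathcomp Require Import all_classical all_reals all_analysis.
From mathcomp.analysis.showcase Require summability.

Set Implicit Arguments.
Unset Strict Implicit.
Unset Printing Implicit Defensive.

Import Order.TTheory GRing.Theory Num.Theory.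
Import numFieldNormedType.Exports.

Local Open Scope classical_set_scope.
Local Open Scope complex_scope.
Local Open Scope ring_scope.

(* The scalar product is linear in the second argument and, by [inner_conj],
   conjugate linear in the first one; [inner_norm] makes it positive definite
   and ties it to the norm (hence to the topology) of the space. *)
HB.mixin Record isHilbert (R : realType) (X : Type)
    of CompleteNormedModule R[i] X := {
  inner : X -> X -> R[i];
  innerDr : forall x y z, inner x (y + z) = inner x y + inner x z;
  innerZr : forall (a : R[i]) x y, inner x (a *: y) = a * inner x y;
  inner_conj : forall x y, inner y x = (inner x y)^*;
  inner_norm : forall x, inner x x = `|x| ^+ 2
}.

#[short(type="hilbertType")]
HB.structure Definition Hilbert (R : realType) :=
  {X of CompleteNormedModule R[i] X & isHilbert R X}.

Definition infinite_dimensional {R : realType} (Z : lmodType R[i]) : Prop :=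
  ~ exists n (b : 'I_n -> Z), forall x, exists c : 'I_n -> R[i],
      x = \sum_(i < n) c i *: b i.

Section HilbertSpace.
Context {R : realType} {X : hilbertType R}.

Definition orthonormal_system {I : eqType} (e : I -> X) : Prop :=
  forall i j, inner (e i) (e j) = (i == j)%:R.

(* maximal orthonormal system; [I] may be uncountable *)
Definition orthonormal_basis {I : choiceType} (e : I -> X) : Prop :=
  orthonormal_system e /\ forall x, (forall i, inner (e i) x = 0) -> x = 0.

Definition unitary : set {linear X -> X} :=
  [set U | set_surj setT setT U /\
           forall x y, inner (U x) (U y) = inner x y].

(* The sum over an orthonormal basis is unordered, i.e. the limit of the net of
   its finite partial sums.  The value is 0 if there is no common sum, which
   does not happen for trace class operators. *)
Definition trace (A : X -> X) : R[i] :=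
  xget 0 [set t : R[i]^o |
    forall (I : choiceType) (e : I -> X), orthonormal_basis e ->
      summability.partial_sum (fun i => inner (e i) (A (e i)) : R[i]^o) @
        summability.totally --> t].

End HilbertSpace.

Arguments unitary {R} X.

Section Operators.
Context {R : realType} {X Y : hilbertType R}.

(* In particular, a compact operator is bounded. *)
Definition compact_operator (C : {linear X -> Y}) : Prop :=
  compact (closure (C @` [set x | `|x| <= 1])).

(* The last clause is convergence in operator norm, ||C - C_n|| <= eps being
   unfolded to |C x - C_n x| <= eps |x| for all x. *)
Definition schmidt_decomposition (C : {linear X -> Y})
    (s : nat -> R) (f : nat -> X) (g : nat -> Y) : Prop :=
  [/\ nonincreasing_seq s /\ (forall n, 0 <= s n), s @ \oo --> (0 : R),
      orthonormal_system f, orthonormal_system g &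
      forall eps : R, 0 < eps -> \forall n \near \oo, forall x,
        `|C x - \sum_(k < n) ((s k)%:C * inner (f k) x) *: g k|
          <= eps%:C * `|x|].

(* Numbered from 0: [singular_numbers C j] is s_{j+1}(C). *)
Definition singular_numbers (C : {linear X -> Y}) : nat -> R :=
  xget (fun=> 0) [set s | exists f g, schmidt_decomposition C s f g].

Definition schatten_class (p : \bar R) : set {linear X -> Y} :=
  [set C | compact_operator C /\
    match p with
    | r%:E => cvgn (series (fun n => singular_numbers C n `^ r))
    | +oo%E => True
    | -oo%E => False
    end].

End Operators.

Definition S_set {R : realType} {X Y : hilbertType R}
    (C : {linear X -> Y}) (T : {linear Y -> X}) : set R[i]^o :=
  [set trace (C \o U \o T \o V) | U in unitary X & V in unitary Y].

Definition closed_disk {R : realType} (r : R) : set R[i]^o :=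
  [set z | `|z| <= r%:C].

(* Main.v *)
Require Import Defs.
From HB Require Import structures.
From mathcomp Require Import all_boot all_order all_algebra.
From mathcomp Require Import finmap complex.
From mathcomp Require Import all_classical all_reals all_analysis.
From mathcomp Require Import ring lra zify.
From mathcomp.analysis.showcase Require summability.

(** Why the theorem is true.  Write the Schmidt decompositions
   C = sum_j s_j <f_j, .> g_j and T = sum_k t_k <h_k, .> l_k.

   Upper bound.  The trace of C U T V is the double sum of s_j t_k d_jk with
   d_jk = <f_j, U l_k> <h_k, V g_j>.  By Bessel's inequality and the inequality
   of arithmetic and geometric means, the matrix |d_jk| has row and column sums
   at most 1, and for decreasing weights such a matrix cannot do better than
   the identity ([substochastic_sum_le], two summations by parts): the double
   sum is at most r = sum_j s_j t_j.  The same argument bounds every finite sum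
   of diagonal coefficients <e_i, C T e_i> with orthonormal e_i
   ([schmidt_pairing_le]).  Applied to C minus its truncation C_N, it bounds all
   such sums by sum_j s_(N+j) t_j, which tends to 0 ([shifted_sum_small]).  This
   one estimate does all the work that the trace norm would do: it reduces
   traces over an arbitrary orthonormal basis to those of the finite rank
   operators C_N T, where Parseval's identity applies, and it shows
   that |tr (C T) - sum_(j < N) s_j <f_j, T g_j>| <= sum_j s_(N+j) t_j
   ([trace_approx]).

   Density in the disk.  The last error only depends on the singular numbers,
   hence is uniform in U and V.  Given |c| <= 1, choose U and V, for a large N,
   with V g_j = h_j and U l_j = c f_j + (1 - |c|^2)^(1/2) f_(N+j) for j < N;
   both prescriptions are orthonormal, so unitary operators doing this exist
   ([unitary_extension], a product of complex reflections).  Then the partial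
   sum is exactly c times sum_(j < N) s_j t_j, and tr (C U T V) is close to c r
   ([trace_unitary_dense]).  Taking c = 1 gives the supremum, and letting c
   range over the unit disk gives the closure.

   Two ingredients make this meaningful: compact operators between infinite
   dimensional spaces do have Schmidt decompositions
   ([schmidt_decomposition_exists]), and the sum of s_j t_j converges, which is
   Young's inequality term by term ([schatten_is_cvg_series]). *)

Set Implicit Arguments.
Unset Strict Implicit.
Unset Printing Implicit Defensive.

Import Order.TTheory GRing.Theory Num.Theory.
Import numFieldNormedType.Exports.

Local Open Scope classical_set_scope.
Local Open Scope complex_scope.
Local Open Scope ring_scope.

(** * Substochastic matrices against decreasing weights *)

(** Summation by parts, in the form of an induction: each step trades the
   weight [t n] for the smaller [t n.+1] on the nonnegative partial sum. *)
Lemma abel_sum_ge (F : numDomainType) (t z : nat -> F) (n : nat) :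
  (forall k, t k.+1 <= t k) ->
  (forall m, (m <= n)%N -> 0 <= \sum_(k < m.+1) z k) ->
  t n * \sum_(k < n.+1) z k <= \sum_(k < n.+1) t k * z k.
Proof.
move=> tdecr; elim: n => [|n IHn] zpos; first by rewrite !big_ord1.
rewrite big_ord_recr /= mulrDr [leRHS]big_ord_recr /= lerD2r.
apply: (le_trans _ (IHn _)) => [|m mn]; last by apply: zpos; exact: leqW.
by apply: ler_wpM2r; [exact: zpos|exact: tdecr].
Qed.

(** Against decreasing weights, domination of the partial sums is enough. *)
Lemma abel_sum_le (F : numDomainType) (t x y : nat -> F) (n : nat) :
  (forall k, 0 <= t k) -> (forall k, t k.+1 <= t k) ->
  (forall m, (m <= n)%N -> \sum_(k < m) x k <= \sum_(k < m) y k) ->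
  \sum_(k < n) t k * x k <= \sum_(k < n) t k * y k.
Proof.
move=> t0 tdecr; case: n => [|n] xy; first by rewrite !big_ord0.
have zpos m : (m <= n)%N -> 0 <= \sum_(k < m.+1) (y k - x k).
  by move=> mn; rewrite sumrB subr_ge0 xy.
rewrite -subr_ge0 -sumrB.
under eq_bigr do rewrite -mulrBr.
apply: (le_trans _ (@abel_sum_ge _ t (fun k => y k - x k) n tdecr zpos)).
exact: mulr_ge0 (t0 n) (zpos n (leqnn n)).
Qed.

(** The extreme case of a matrix with row and column sums at most 1 is the
   identity.  Summation by parts in both indices reduces the weights to
   indicators of initial segments, for which the claim is that a block of size
   p times m has total mass at most [minn p m]. *)
Lemma substochastic_sum_le (F : numDomainType) (s t : nat -> F)
    (d : nat -> nat -> F) (n : nat) :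
  (forall k, 0 <= s k) -> (forall k, s k.+1 <= s k) ->
  (forall k, 0 <= t k) -> (forall k, t k.+1 <= t k) ->
  (forall j k, 0 <= d j k) ->
  (forall k, \sum_(j < n) d j k <= 1) -> (forall j, \sum_(k < n) d j k <= 1) ->
  \sum_(j < n) \sum_(k < n) s j * t k * d j k <= \sum_(j < n) s j * t j.
Proof.
move=> s0 sdecr t0 tdecr d0 dcol drow.
have sumD_le1 m a b (D : nat -> nat -> F) : (forall j k, 0 <= D j k) ->
    (m <= b)%N -> \sum_(k < b) D a k <= 1 -> \sum_(k < m) D a k <= 1.
  move=> D0 mb; apply: le_trans.
  rewrite (big_ord_widen b (D a) mb).
  rewrite [leRHS](bigID (fun k : 'I_b => (k < m)%N)) /=.
  by rewrite lerDl sumr_ge0.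
have -> : \sum_(j < n) \sum_(k < n) s j * t k * d j k =
          \sum_(k < n) t k * \sum_(j < n) s j * d j k.
  rewrite exchange_big; apply: eq_bigr => k _; rewrite mulr_sumr.
  by apply: eq_bigr => j _; rewrite mulrCA mulrA.
under [leRHS]eq_bigr do rewrite mulrC.
apply: (@abel_sum_le _ t (fun k => \sum_(j < n) s j * d j k) s) => // m mn.
rewrite exchange_big /=.
under eq_bigr do rewrite -mulr_sumr.
(* The second summation by parts compares with the indicator of [0, m). *)
have -> : \sum_(k < m) s k = \sum_(j < n) s j * (j < m)%N%:R.
  rewrite (big_ord_widen n s mn) big_mkcond /=.
  by apply: eq_bigr => j _; case: ifP; rewrite (mulr1, mulr0).
apply: (@abel_sum_le _ s (fun j => \sum_(i < m) d j i)
  (fun j => (j < m)%N%:R)) => // p pn.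
have -> : \sum_(k < p) (k < m)%N%:R = (minn p m)%:R :> F.
  elim: p {pn} => [|p IHp]; first by rewrite big_ord0 min0n.
  rewrite big_ord_recr /= IHp -natrD; congr (_%:R).
  by case: (ltnP p m) => pm /=; lia.
rewrite /minn; case: ltnP => pm.
- apply: le_trans (_ : \sum_(i < p) 1 <= _); last first.
    by rewrite sumr_const card_ord.
  by apply: ler_sum => j _; exact: sumD_le1 (drow j).
- rewrite exchange_big /=.
  apply: le_trans (_ : \sum_(i < m) 1 <= _); last first.
    by rewrite sumr_const card_ord.
  by apply: ler_sum => k _; apply: (@sumD_le1 _ k n (fun k j => d j k)).
Qed.

(** Each product is at most half the sum of the two squares. *)
Lemma sum_mul_le1 (F : numFieldType) (n : nat) (a b : 'I_n -> F) :
  (forall j, 0 <= a j) -> (forall j, 0 <= b j) ->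
  \sum_(j < n) a j ^+ 2 <= 1 -> \sum_(j < n) b j ^+ 2 <= 1 ->
  \sum_(j < n) a j * b j <= 1.
Proof.
move=> a0 b0 a1 b1; rewrite -(@ler_pM2l _ 2) // mulr1 mulr_sumr.
apply: le_trans (_ : \sum_(j < n) (a j ^+ 2 + b j ^+ 2) <= _).
  apply: ler_sum => j _; rewrite -subr_ge0.
  rewrite (_ : _ - _ = (a j - b j) ^+ 2); last by ring.
  by rewrite real_exprn_even_ge0 // realB // ger0_real.
by rewrite big_split (natrD _ 1 1); exact: lerD.
Qed.

(** * Sequences of real and complex numbers *)

(** Young's inequality bounds each term by a combination of the terms of the two
   convergent series. *)
Lemma is_cvg_series_conjugate (R : realType) (p q : R) (s t : R^nat) :
  0 < p -> 0 < q -> p^-1 + q^-1 = 1 ->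
  (forall n, 0 <= s n) -> (forall n, 0 <= t n) ->
  cvgn (series (fun n => s n `^ p)) -> cvgn (series (fun n => t n `^ q)) ->
  cvgn (series (fun n => s n * t n)).
Proof.
move=> p0 q0 pq s0 t0 sp tq.
apply: (series_le_cvg _ _ (fun n => conjugate_powR (s0 n) (t0 n) p0 q0 pq)).
- by move=> n; rewrite mulr_ge0.
- by move=> n; rewrite addr_ge0 ?divr_ge0 ?powR_ge0 ?ltW.
have -> : (fun n => s n `^ p / p + t n `^ q / q) =
          p^-1 *: (fun n => s n `^ p) + q^-1 *: (fun n => t n `^ q).
  by apply/funext => n; rewrite /= mulrC [X in _ + X]mulrC.
by apply: is_cvg_seriesD; apply: is_cvg_seriesZ.
Qed.

(** The limit case of exponents 1 and infinity. *)
Lemma is_cvg_series_mul_decreasing (R : realType) (s t : R^nat) :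
  (forall n, 0 <= s n) -> (forall n, 0 <= t n) -> nonincreasing_seq t ->
  cvgn (series s) -> cvgn (series (fun n => s n * t n)).
Proof.
move=> s0 t0 tdecr cs.
apply: (@series_le_cvg _ _ (t 0%N *: s)) => [n|n|n|].
- by rewrite mulr_ge0.
- by rewrite /= mulr_ge0.
- by rewrite /= mulrC ler_wpM2r // tdecr.
- exact: is_cvg_seriesZ.
Qed.

Lemma sum_le_lim_series (R : realType) (u : R^nat) (n : nat) :
  (forall k, 0 <= u k) -> cvgn (series u) ->
  \sum_(k < n) u k <= limn (series u).
Proof.
move=> u0 cu; rewrite -[X in X <= _](big_mkord xpredT u).
exact: (nondecreasing_cvgn_le (nondecreasing_series (fun k _ _ => u0 k)) cu n).
Qed.

Lemma sum_ord_split (V : nmodType) (u : nat -> V) (m n : nat) :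
  \sum_(j < m + n) u j = \sum_(j < m) u j + \sum_(j < n) u (m + j)%N.
Proof. by rewrite big_split_ord. Qed.

Lemma tail_sum_small (R : realType) (u : R^nat) :
  (forall n, 0 <= u n) -> cvgn (series u) ->
  forall eps : R, 0 < eps -> \forall M \near \oo, forall n,
    \sum_(j < n) u (M + j)%N <= eps.
Proof.
move=> u0 cu eps eps0; set r := limn (series u).
near=> M => n.
have h : r - eps <= \sum_(j < M) u j.
  rewrite -(big_mkord xpredT u); apply: ltW; near: M.
  by apply: (cvgr_gt r) => //; rewrite ltrBlDr ltrDl.
rewrite -(lerD2l (\sum_(j < M) u j)) -sum_ord_split.
by apply: le_trans (_ : r <= _); [exact: sum_le_lim_series|rewrite -lerBlDr].
Unshelve. all: by end_near. Qed.

(** Only one of the two sequences is shifted.  The first [K] terms are small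
   because [s] tends to 0, the others because they are below a tail of the
   convergent series; this is where operators of the class of exponent infinity
   have to be compact rather than just bounded. *)
Lemma shifted_sum_small (R : realType) (s t : R^nat) :
  (forall n, 0 <= s n) -> nonincreasing_seq s -> s @ \oo --> (0 : R) ->
  (forall n, 0 <= t n) -> nonincreasing_seq t ->
  cvgn (series (fun n => s n * t n)) ->
  forall eps : R, 0 < eps -> \forall M \near \oo, forall n,
    \sum_(j < n) s (M + j)%N * t j <= eps.
Proof.
move=> s0 sdecr slim t0 tdecr cst eps eps0.
have eps20 : 0 < eps / 2 by rewrite divr_gt0.
(* [K] is chosen first, from the series alone; [M] then depends on [K]. *)
have [K _ /(_ K (leqnn K)) tailK] :=
  tail_sum_small (fun n => mulr_ge0 (s0 n) (t0 n)) cst eps20.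
near=> M => n.
apply: le_trans (_ : \sum_(j < K + n) s (M + j)%N * t j <= _).
  rewrite (addnC K) (sum_ord_split (fun j => s (M + j)%N * t j)) lerDl.
  by rewrite sumr_ge0 // => j _; exact: mulr_ge0.
rewrite (sum_ord_split (fun j => s (M + j)%N * t j)) (splitr eps).
rewrite lerD //; last first.
  apply: le_trans (tailK n); apply: ler_sum => j _; rewrite ler_wpM2r //.
  by apply: sdecr; rewrite leq_addl.
(* The added 1 keeps the divisor positive. *)
apply: le_trans (_ : s M * (K%:R * t 0%N + 1) <= _).
  apply: le_trans (_ : \sum_(j < K) s M * t 0%N <= _).
    apply: ler_sum => j _; apply: ler_pM => //; last exact: tdecr.
    by apply: sdecr; rewrite leq_addr.
  rewrite sumr_const card_ord -[leLHS]mulr_natl mulrCA mulrDr mulr1.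
  by rewrite lerDl.
rewrite -ler_pdivlMr; last by rewrite ltr_wpDl // mulr_ge0.
apply: ltW; near: M; apply: (cvgr_lt (0 : R)) => //.
by rewrite divr_gt0 // ltr_wpDl // mulr_ge0.
Unshelve. all: by end_near. Qed.

(** The real and imaginary parts of a Cauchy sequence are Cauchy. *)
Lemma complex_cauchy_cvg (R : realType) (u : nat -> R[i]) :
  (forall eps : R, 0 < eps -> exists N, forall n, (N <= n)%N ->
     `|u n - u N| <= eps%:C) ->
  exists l : R[i], forall eps : R, 0 < eps ->
    \forall n \near \oo, `|u n - l| <= eps%:C.
Proof.
move=> ucauchy.
have part_cvg (h : R[i] -> R) : {morph h : x y / x - y} ->
    (forall z, `|h z|%:C <= `|z|) -> cvgn (h \o u).
  move=> hB hle; apply/cauchy_cvgP/cauchy_exP => eps eps0.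
  have [N uN] := ucauchy (eps / 2) (divr_gt0 eps0 (ltr0Sn _ _)).
  exists (h (u N)); exists N => // n /= Nn.
  rewrite /ball /= -hB -ltcR.
  apply: le_lt_trans (hle _) _; rewrite distrC.
  by apply: le_lt_trans (uN n Nn) _; rewrite ltcR; lra.
have normIm (z : R[i]) : `|complex.Im z|%:C <= `|z|.
  by case: z => a b; simpc; rewrite -sqrtr_sqr ler_wsqrtr // lerDr sqr_ge0.
have cRe := part_cvg (@complex.Re R) (fun x y => ltac:(by case: x; case: y))
  (@normc_ge_Re R).
have cIm := part_cvg (@complex.Im R) (fun x y => ltac:(by case: x; case: y))
  normIm.
exists (limn (@complex.Re R \o u) +i* limn (@complex.Im R \o u)) => eps eps0.
near=> n.
rewrite [_ - _]complexE.
apply: le_trans (ler_normD _ _) _.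
rewrite normrM (_ : `|'i%C| = 1) ?mul1r; last first.
  by rewrite normc_def /= expr0n /= add0r expr1n sqrtr1.
rewrite !normc_def /= expr0n /= !addr0 !sqrtr_sqr -rmorphD lecR (splitr eps).
have -> a b (z : R[i]) : complex.Re (z - (a +i* b)) = complex.Re z - a.
  by case: z.
have -> a b (z : R[i]) : complex.Im (z - (a +i* b)) = complex.Im z - b.
  by case: z.
apply: lerD; rewrite distrC; near: n.
  by apply: (cvgr_dist_le _ _ cRe); rewrite divr_gt0.
by apply: (cvgr_dist_le _ _ cIm); rewrite divr_gt0.
Unshelve. all: by end_near. Qed.

Lemma le_addepsC (R : realType) (z : R[i]) (a : R) : 0 <= z ->
  (forall eps : R, 0 < eps -> z <= (a + eps)%:C) -> z <= a%:C.
Proof.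
move=> z0 zle; have := RRe_real (ger0_real z0); move: zle => /[swap] <- zle.
rewrite lecR; apply/ler_addgt0Pr => eps eps0.
by rewrite -lecR; exact: zle.
Qed.

(** * Geometry of the inner product *)

Section InnerProduct.
Context {R : realType} {X : hilbertType R}.
Implicit Types (x y z : X) (a : R[i]).

Lemma inner0r x : inner x 0 = 0.
Proof. by rewrite -(scale0r (0 : X)) innerZr mul0r. Qed.

Lemma innerNr x y : inner x (- y) = - inner x y.
Proof. by rewrite -scaleN1r innerZr mulN1r. Qed.

Lemma innerBr x y z : inner x (y - z) = inner x y - inner x z.
Proof. by rewrite innerDr innerNr. Qed.

Lemma inner_sumr (I : Type) (r : seq I) (P : pred I) x (u : I -> X) :
  inner x (\sum_(i <- r | P i) u i) = \sum_(i <- r | P i) inner x (u i).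
Proof. exact: (big_morph _ (innerDr x) (inner0r x)). Qed.

Lemma innerDl x y z : inner (x + y) z = inner x z + inner y z.
Proof. by rewrite inner_conj innerDr rmorphD /= -!inner_conj. Qed.

Lemma innerZl a x y : inner (a *: x) y = (a^*)%R * inner x y.
Proof. by rewrite inner_conj innerZr rmorphM /= -!inner_conj. Qed.

Lemma innerBl x y z : inner (x - y) z = inner x z - inner y z.
Proof. by rewrite inner_conj innerBr rmorphB /= -!inner_conj. Qed.

Lemma inner_suml (I : Type) (r : seq I) (P : pred I) (u : I -> X) x :
  inner (\sum_(i <- r | P i) u i) x = \sum_(i <- r | P i) inner (u i) x.
Proof.
rewrite inner_conj inner_sumr rmorph_sum /=.
by apply: eq_bigr => i _; rewrite -inner_conj.
Qed.

Lemma inner_eq0C x y : inner x y = 0 -> inner y x = 0.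
Proof. by move=> xy; rewrite inner_conj xy conjC0. Qed.

Lemma norm_innerC x y : `|inner x y| = `|inner y x|.
Proof. by rewrite inner_conj norm_conjC. Qed.

Lemma normD_sqr x y :
  `|x + y| ^+ 2 = `|x| ^+ 2 + `|y| ^+ 2 + (inner x y + inner y x).
Proof. by rewrite -!inner_norm innerDl !innerDr; ring. Qed.

Lemma normB_sqr x y :
  `|x - y| ^+ 2 = `|x| ^+ 2 + `|y| ^+ 2 - (inner x y + inner y x).
Proof. by rewrite -!inner_norm innerBl !innerBr; ring. Qed.

Lemma parallelogram x y :
  `|x + y| ^+ 2 + `|x - y| ^+ 2 = 2 * (`|x| ^+ 2 + `|y| ^+ 2).
Proof. by rewrite normD_sqr normB_sqr; ring. Qed.

Lemma pythagoras x y : inner x y = 0 ->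
  `|x + y| ^+ 2 = `|x| ^+ 2 + `|y| ^+ 2.
Proof. by move=> xy; rewrite normD_sqr xy (inner_eq0C xy) !addr0. Qed.

Section Orthonormal.
Context {I : eqType} {e : I -> X}.
Hypothesis onE : orthonormal_system e.

Lemma orthonormal_norm i : `|e i| = 1.
Proof.
apply/eqP; rewrite -(@eqrXn2 _ 2) // -inner_norm onE eqxx.
by rewrite expr1n.
Qed.

Lemma inner_comb (r : seq I) (c : I -> R[i]) i : uniq r -> i \in r ->
  inner (e i) (\sum_(j <- r) c j *: e j) = c i.
Proof.
move=> ur ir; rewrite inner_sumr (bigD1_seq i) //= innerZr onE eqxx mulr1.
rewrite big1 ?addr0 // => j /negbTE ji.
by rewrite innerZr onE eq_sym ji mulr0.
Qed.

Lemma norm_comb (r : seq I) (c : I -> R[i]) : uniq r ->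
  `|\sum_(j <- r) c j *: e j| ^+ 2 = \sum_(j <- r) `|c j| ^+ 2.
Proof.
move=> ur; rewrite -inner_norm inner_suml [LHS]big_seq [RHS]big_seq.
apply: eq_bigr => j jr.
by rewrite innerZl inner_comb // mulrC normCK.
Qed.

(** Bessel's inequality with its exact defect, which also measures how far a
   Fourier sum is from the vector. *)
Lemma norm_fourier_rest (r : seq I) x : uniq r ->
  `|x - \sum_(j <- r) inner (e j) x *: e j| ^+ 2 =
  `|x| ^+ 2 - \sum_(j <- r) `|inner (e j) x| ^+ 2.
Proof.
move=> ur; rewrite normB_sqr norm_comb //.
rewrite inner_sumr inner_suml -big_split /=.
rewrite [X in _ - X](_ : _ =
  \sum_(j <- r) `|inner (e j) x| ^+ 2 + \sum_(j <- r) `|inner (e j) x| ^+ 2).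
  by ring.
rewrite -big_split; apply: eq_bigr => j _ /=.
by rewrite innerZr innerZl !normCK -!inner_conj; ring.
Qed.

Lemma bessel (r : seq I) x : uniq r ->
  \sum_(j <- r) `|inner (e j) x| ^+ 2 <= `|x| ^+ 2.
Proof. by move=> ur; rewrite -subr_ge0 -norm_fourier_rest // exprn_ge0. Qed.

Lemma norm_projection (r : seq I) x : uniq r ->
  `|\sum_(j <- r) inner (e j) x *: e j| <= `|x|.
Proof.
by move=> ur; rewrite -(@ler_pXn2r _ 2) ?nnegrE // norm_comb //; exact: bessel.
Qed.

End Orthonormal.

Lemma cauchy_schwarz x y : `|inner x y| <= `|x| * `|y|.
Proof.
have [->|x0] := eqVneq x 0.
  by rewrite inner_conj inner0r conjC0 !normr0 mul0r.
have nx0 : `|x| != 0 by rewrite normr_eq0.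
pose e (_ : unit) := `|x|^-1 *: x.
have onE : orthonormal_system e.
  move=> [] []; rewrite eqxx innerZl innerZr inner_norm.
  rewrite (CrealP _) ?ger0_real ?invr_ge0 //.
  by rewrite expr2 mulKf // mulVf.
have := bessel onE (r := [:: tt]) y isT.
rewrite big_seq1 ler_pXn2r ?nnegrE // innerZl normrM norm_conjC normfV normr_id.
by rewrite ler_pdivrMl // lt_def nx0 normr_ge0.
Qed.

End InnerProduct.

Section RealNorm.
Context {R : realType} {X : hilbertType R}.
Implicit Types x y : X.

(** Norms take values in the partially ordered field [R[i]]; a real-valued copy
   gives access to suprema and to decision procedures for real arithmetic. *)
Definition rnorm x : R := complex.Re `|x|.

Lemma rnormE x : `|x| = (rnorm x)%:C.
Proof. by rewrite RRe_real // ger0_real. Qed.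

Lemma rnorm_ge0 x : 0 <= rnorm x. Proof. by rewrite -ler0c -rnormE. Qed.

Lemma rnormD x y : rnorm (x + y) <= rnorm x + rnorm y.
Proof. by rewrite -lecR rmorphD /= -!rnormE ler_normD. Qed.

Lemma rnormB x y : rnorm (x - y) = rnorm (y - x).
Proof. by rewrite /rnorm distrC. Qed.

Lemma rnorm_parallelogram x y :
  rnorm (x + y) ^+ 2 + rnorm (x - y) ^+ 2 = 2 * (rnorm x ^+ 2 + rnorm y ^+ 2).
Proof.
apply: complexI; rewrite rmorphM rmorph_nat !rmorphD !rmorphXn /= -!rnormE.
exact: parallelogram.
Qed.

Lemma rnormZ (a : R[i]) x : rnorm (a *: x) = complex.Re `|a| * rnorm x.
Proof.
apply: complexI; rewrite rmorphM /= -!rnormE normrZ.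
by rewrite (RRe_real (ger0_real (normr_ge0 a))).
Qed.

Lemma rnorm0 : rnorm (0 : X) = 0. Proof. by rewrite /rnorm normr0. Qed.

Lemma rnorm_eq0 x : (rnorm x == 0) = (x == 0).
Proof.
by rewrite -(normr_eq0 x) rnormE; apply/eqP/eqP => [->//|]; apply: complexI.
Qed.

Lemma rnorm_le x (a : R) : (rnorm x <= a) = (`|x| <= a%:C).
Proof. by rewrite rnormE lecR. Qed.

Lemma rnorm_eq1 x : (rnorm x = 1) <-> (`|x| = 1).
Proof. by rewrite rnormE; split=> [->//|]; apply: complexI. Qed.

End RealNorm.

(** * Finite diagonal sums of a product of two Schmidt expansions *)

Section Truncation.
Context {R : realType} {X Y : hilbertType R}.

Definition truncation (s : nat -> R) (f : nat -> X) (g : nat -> Y) (n : nat)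
    (x : X) : Y :=
  \sum_(k < n) ((s k)%:C * inner (f k) x) *: g k.

(** This is [schmidt_decomposition] for a bare function, so that it also applies
   to the difference of an operator and its truncation. *)
Definition schmidt_form (A : X -> Y) (s : nat -> R) (f : nat -> X)
    (g : nat -> Y) : Prop :=
  [/\ nonincreasing_seq s /\ (forall n, 0 <= s n), s @ \oo --> (0 : R),
      orthonormal_system f, orthonormal_system g &
      forall eps : R, 0 < eps -> \forall n \near \oo, forall x,
        `|A x - truncation s f g n x| <= eps%:C * `|x|].

Lemma truncationB s f g n x y :
  truncation s f g n (x - y) = truncation s f g n x - truncation s f g n y.
Proof.
rewrite -sumrB; apply: eq_bigr => k _.
by rewrite innerBr mulrBr scalerBl.
Qed.

Lemma truncation_split s f g m n x :
  truncation s f g (m + n) x = truncation s f g m x +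
  truncation (fun k => s (m + k)%N) (fun k => f (m + k)%N)
             (fun k => g (m + k)%N) n x.
Proof.
exact: (sum_ord_split (fun k => ((s k)%:C * inner (f k) x) *: g k)).
Qed.

Lemma bessel_ord (e : nat -> X) n x : orthonormal_system e ->
  \sum_(j < n) `|inner (e j) x| ^+ 2 <= `|x| ^+ 2.
Proof.
move=> one; rewrite -(big_mkord xpredT (fun j => `|inner (e j) x| ^+ 2)).
by apply: bessel; rewrite ?iota_uniq.
Qed.

Lemma truncation_bound s f g n x : nonincreasing_seq s ->
  (forall k, 0 <= s k) -> orthonormal_system f -> orthonormal_system g ->
  `|truncation s f g n x| <= (s 0%N)%:C * `|x|.
Proof.
move=> sdecr s0 onf ong.
have s00 : 0 <= (s 0%N)%:C by rewrite lecR.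
rewrite -(@ler_pXn2r _ 2) ?nnegrE ?mulr_ge0 // /truncation.
rewrite -(big_mkord xpredT (fun k => ((s k)%:C * inner (f k) x) *: g k)).
rewrite norm_comb ?iota_uniq // exprMn big_mkord.
apply: le_trans (ler_wpM2l _ (bessel_ord n x onf)); last exact: exprn_ge0.
rewrite mulr_sumr; apply: ler_sum => k _.
rewrite normrM exprMn ler_wpM2r ?exprn_ge0 //.
rewrite ler_pXn2r ?nnegrE // normc_def /= expr0n addr0 sqrtr_sqr lecR.
rewrite ger0_norm //.
exact: sdecr.
Qed.

Lemma schmidt_form_bound (A : X -> Y) s f g x : schmidt_form A s f g ->
  `|A x| <= (s 0%N + 1)%:C * `|x|.
Proof.
case=> [[sdecr s0] _ onf ong /(_ 1 ltr01)[N _ /(_ N (leqnn N) x)]] A1.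
rewrite -[A x](subrK (truncation s f g N x)) addrC rmorphD mulrDl.
apply: le_trans (ler_normD _ _) _.
by apply: lerD; [exact: truncation_bound|exact: A1].
Qed.

Lemma schmidt_form_coef (A : X -> Y) s f g j x : schmidt_form A s f g ->
  inner (g j) (A x) = (s j)%:C * inner (f j) x.
Proof.
case=> _ _ onf ong Alim; apply/eqP; rewrite -subr_eq0 -normr_le0.
apply: (@le_addepsC _ _ 0) => // eps eps0; rewrite add0r.
have d0 : 0 < eps / (rnorm x + 1) by rewrite divr_gt0 // ltr_wpDl ?rnorm_ge0.
have [N _ /(_ (N + j.+1)%N (leq_addr _ _) x) AN] := Alim _ d0.
have -> : (s j)%:C * inner (f j) x =
    inner (g j) (truncation s f g (N + j.+1) x).
  rewrite /truncation.
  rewrite -(big_mkord xpredT (fun k => ((s k)%:C * inner (f k) x) *: g k)).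
  by rewrite inner_comb ?iota_uniq // mem_index_iota addnS ltnS leq_addl.
rewrite -innerBr; apply: le_trans (cauchy_schwarz _ _) _.
rewrite orthonormal_norm // mul1r; apply: le_trans AN _.
rewrite rnormE -rmorphM lecR mulrAC ler_pdivrMr ?ltr_wpDl ?rnorm_ge0 //.
by rewrite ler_pM2l // lerDl.
Qed.

(** Removing the first [m] terms shifts the singular numbers; this turns every
   bound below into a bound on remainders. *)
Lemma schmidt_form_shift (A : X -> Y) s f g m : schmidt_form A s f g ->
  schmidt_form (fun x => A x - truncation s f g m x)
    (fun k => s (m + k)%N) (fun k => f (m + k)%N) (fun k => g (m + k)%N).
Proof.
case=> [[sdecr s0] slim onf ong Alim]; split.
- by split=> // a b ab; apply: sdecr; rewrite leq_add2l.
- by under eq_fun do rewrite addnC; move: slim; rewrite -(cvg_shiftn m).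
- by move=> i j; rewrite onf eqn_add2l.
- by move=> i j; rewrite ong eqn_add2l.
- move=> eps eps0; have [N _ AN] := Alim eps eps0.
  exists N => // n /= Nn x.
  rewrite -addrA -opprD -truncation_split; apply: AN => /=.
  exact: leq_trans Nn (leq_addl _ _).
Qed.

End Truncation.

Section Pairing.
Context {R : realType} {X Y : hilbertType R}.
Variables (s t : nat -> R).
Variables (f l : nat -> X) (g h : nat -> Y).
Variables (I : eqType) (e : I -> Y) (r : seq I).
Hypotheses (one : orthonormal_system e) (ur : uniq r).

(** With [P] the orthogonal projection onto the span of the [e i], the sum is
   that of [s j * t k * (<f j, l k> * <P (h k), g j>)] over [j] and [k].  Since
   [P] is symmetric and does not increase norms, Bessel's inequality applies to
   both factors along rows and along columns. *)
Lemma truncation_pairing_le n :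
  nonincreasing_seq s -> (forall k, 0 <= s k) ->
  nonincreasing_seq t -> (forall k, 0 <= t k) ->
  orthonormal_system f -> orthonormal_system g ->
  orthonormal_system h -> orthonormal_system l ->
  `|\sum_(i <- r) inner (e i) (truncation s f g n (truncation t h l n (e i)))|
    <= (\sum_(j < n) s j * t j)%:C.
Proof.
move=> sdecr s0 tdecr t0 onf ong onh onl.
pose P y := \sum_(i <- r) inner (e i) y *: e i.
have Psym y z : inner (P y) z = inner y (P z).
  rewrite inner_suml inner_sumr; apply: eq_bigr => i _.
  by rewrite innerZl innerZr -inner_conj mulrC.
pose d j k := `|inner (f j) (l k)| * `|inner (P (h k)) (g j)|.
have -> : \sum_(i <- r)
      inner (e i) (truncation s f g n (truncation t h l n (e i))) =
    \sum_(j < n) \sum_(k < n)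
      (s j)%:C * (t k)%:C * (inner (f j) (l k) * inner (P (h k)) (g j)).
  under eq_bigr do rewrite inner_sumr.
  rewrite exchange_big; apply: eq_bigr => j _ /=.
  under eq_bigr do rewrite innerZr inner_sumr mulr_sumr mulr_suml.
  rewrite exchange_big; apply: eq_bigr => k _ /=.
  rewrite inner_suml !mulr_sumr; apply: eq_bigr => i _.
  by rewrite innerZr innerZl -inner_conj; ring.
apply: le_trans (_ : \sum_(j < n) \sum_(k < n)
    (s j)%:C * (t k)%:C * d j k <= _).
  apply: le_trans (ler_norm_sum _ _ _) _; apply: ler_sum => j _.
  apply: le_trans (ler_norm_sum _ _ _) _; apply: ler_sum => k _.
  by rewrite !normrM !(ger0_norm (_ : 0 <= _%:C)) // ?lecR.
rewrite rmorph_sum; under [leRHS]eq_bigr do rewrite rmorphM.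
have norm_le1 (y : Y) : `|y| = 1 -> `|P y| ^+ 2 <= 1.
  by move=> y1; rewrite exprn_ile1 // -y1; exact: norm_projection.
apply: (@substochastic_sum_le _ (fun j => (s j)%:C) (fun k => (t k)%:C)).
- by move=> k; rewrite lecR.
- by move=> k; rewrite lecR; exact: sdecr.
- by move=> k; rewrite lecR.
- by move=> k; rewrite lecR; exact: tdecr.
- by move=> j k; rewrite mulr_ge0.
- move=> k; apply: sum_mul_le1 => //.
    apply: le_trans (bessel_ord n (l k) onf) _.
    by rewrite orthonormal_norm ?expr1n.
  under eq_bigr do rewrite norm_innerC.
  apply: le_trans (bessel_ord n _ ong) _.
  by apply: norm_le1; rewrite orthonormal_norm.
- move=> j; apply: sum_mul_le1 => //.
    under eq_bigr do rewrite norm_innerC.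
    apply: le_trans (bessel_ord n (f j) onl) _.
    by rewrite orthonormal_norm ?expr1n.
  under eq_bigr do rewrite Psym.
  apply: le_trans (bessel_ord n _ onh) _.
  by apply: norm_le1; rewrite orthonormal_norm.
Qed.

(** A finite diagonal sum is continuous under norm limits, so the bound passes
   from truncations to the operators. *)
Lemma schmidt_pairing_le (A : X -> Y) (T : Y -> X) (b : R) :
  schmidt_form A s f g -> schmidt_form T t h l ->
  (forall n, \sum_(j < n) s j * t j <= b) ->
  `|\sum_(i <- r) inner (e i) (A (T (e i)))| <= b%:C.
Proof.
move=> hA hT stb; have [[sdecr s0] _ onf ong Alim] := hA.
have [[tdecr t0] _ onh onl Tlim] := hT.
apply: le_addepsC => // eps eps0.
(* [c] collects the norm of [T] and that of the truncation of [A]. *)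
pose c : R := t 0%N + 1 + s 0%N.
have c0 : 0 < c by rewrite ltr_wpDr // ltr_wpDl.
pose q : R := (size r)%:R + 1.
have q0 : 0 < q by rewrite ltr_wpDl.
pose dl := eps / (q * c).
have dl0 : 0 < dl by rewrite divr_gt0 // mulr_gt0.
have [N1 _ AN] := Alim dl dl0; have [N2 _ TN] := Tlim dl dl0.
pose n := (N1 + N2)%N.
have {}AN := AN n (leq_addr _ _); have {}TN := TN n (leq_addl _ _).
rewrite rmorphD -(subrK (\sum_(i <- r)
  inner (e i) (truncation s f g n (truncation t h l n (e i))))
  (\sum_(i <- r) _)).
rewrite addrC; apply: le_trans (ler_normD _ _) _; apply: lerD.
  apply: le_trans (truncation_pairing_le n _ _ _ _ _ _ _ _) _ => //.
  by rewrite lecR.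
rewrite -sumrB; apply: le_trans (ler_norm_sum _ _ _) _.
have dlcE : (dl * c)%:C = dl%:C * (t 0%N + 1)%:C + dl%:C * (s 0%N)%:C.
  by rewrite -!rmorphM -rmorphD -mulrDr.
apply: le_trans (_ : \sum_(i <- r) (dl * c)%:C <= _).
  apply: ler_sum => i _; rewrite -innerBr.
  apply: le_trans (cauchy_schwarz _ _) _; rewrite (orthonormal_norm one) mul1r.
  rewrite -(subrK (truncation s f g n (T (e i))) (A _)) -addrA -truncationB.
  apply: le_trans (ler_normD _ _) _; rewrite dlcE.
  apply: lerD.
    apply: le_trans (AN _) _; apply: ler_wpM2l; first by rewrite lecR ltW.
    have := schmidt_form_bound (e i) hT.
    by rewrite (orthonormal_norm one) mulr1.
  apply: le_trans (truncation_bound _ _ _ _ _ _) _ => //.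
  rewrite mulrC ler_wpM2r // ?lecR //.
  by have := TN (e i); rewrite (orthonormal_norm one) mulr1.
rewrite big_const_seq count_predT iter_addr_0 -rmorphMn lecR.
have -> : dl * c = eps / q.
  by rewrite /dl; field; rewrite !gt_eqF.
rewrite -mulr_natl mulrA ler_pdivrMr // mulrC ler_pM2l //.
by rewrite /q lerDl.
Qed.

End Pairing.

(** * Orthonormal bases and Fourier expansions *)

Section Fourier.
Context {R : realType} {X : hilbertType R}.

Lemma hilbert_cauchy_cvg (u : nat -> X) :
  (forall eps : R, 0 < eps -> exists N, forall n, (N <= n)%N ->
     `|u n - u N| <= eps%:C) ->
  exists l : X, forall eps : R, 0 < eps ->
    \forall n \near \oo, `|u n - l| <= eps%:C.
Proof.
move=> ucauchy.
have /cvg_ex[l ul] : cvgn u.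
  apply/cauchy_cvgP/cauchy_exP => eps eps0.
  have epsE : eps = (complex.Re eps)%:C by rewrite RRe_real ?gtr0_real.
  have e0 : 0 < complex.Re eps by rewrite -ltcR -epsE.
  have [N uN] := ucauchy (complex.Re eps / 2) (divr_gt0 e0 (ltr0Sn _ _)).
  exists (u N); exists N => // n /= Nn.
  rewrite -ball_normE /= distrC; apply: le_lt_trans (uN n Nn) _.
  by rewrite epsE ltcR; lra.
exists l => eps eps0; near=> n; rewrite distrC; near: n.
by move/cvgrPdist_le : ul; apply; rewrite ltcR.
Unshelve. all: by end_near. Qed.

(** Zorn's lemma: a unit vector orthogonal to a maximal orthonormal set could be
   added to it. *)
Lemma exists_orthonormal_basis :
  exists (I : choiceType) (e : I -> X), orthonormal_basis e.
Proof.
pose P (A : set X) := forall x y, A x -> A y -> inner x y = (x == y)%:R.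
have [F FP Ftot|A [PA Amax]] := @Zorn_bigcup X P.
  move=> x y [A FA Ax] [B FB By].
  by have [AB|BA] := Ftot _ _ FA FB; [apply: (FP B)|apply: (FP A)] => //;
    [exact: AB|exact: BA].
exists (set_type A), (fun i => val i); split.
  by move=> i j; rewrite PA //; exact: set_valP.
move=> x xA; apply/eqP; apply: contrapT => /negP x0.
have nx0 : `|x| != 0 by rewrite normr_eq0.
pose y := `|x|^-1 *: x.
have yA z : A z -> inner z y = 0.
  move=> Az; have /= := xA (SigSub (mem_set Az)).
  by rewrite innerZr => ->; rewrite mulr0.
have y1 : inner y y = 1.
  rewrite innerZl innerZr inner_norm.
  rewrite (CrealP _) ?ger0_real ?invr_ge0 //.
  by rewrite expr2 mulKf // mulVf.
have nAy : ~ A y by move=> /yA; rewrite y1 => /eqP; rewrite oner_eq0.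
apply: (Amax (A `|` [set y])).
  by split=> [z Az|/(_ y (or_intror erefl))//]; left.
move=> u v [Au|->] [Av|->]; first exact: PA.
- rewrite yA //; case: eqP => // uy; by rewrite uy in Au.
- rewrite (inner_eq0C (yA _ Av)); case: eqP => // vy; by rewrite -vy in Av.
- by rewrite y1 eqxx.
Qed.

Context {I : choiceType} {e : I -> X}.
Hypothesis basis_e : orthonormal_basis e.

Let v x (F : {fset I}) : X := \sum_(i <- F) inner (e i) x *: e i.

(** The Fourier sum over [F] is that of the Fourier sum over [F'], so the
   distance between the two is the defect in Bessel's inequality. *)
Lemma fourier_gap x (F F' : {fset I}) : (F `<=` F')%fset ->
  `|v x F' - v x F| ^+ 2 = \sum_(i <- F') `|inner (e i) x| ^+ 2 -
                           \sum_(i <- F) `|inner (e i) x| ^+ 2.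
Proof.
move=> FF'; have [one _] := basis_e.
have coef i : i \in F -> inner (e i) (v x F') = inner (e i) x.
  by move=> iF; rewrite inner_comb // (fsubsetP FF').
rewrite -(norm_comb one) // -/(v x F').
have -> : v x F = \sum_(i <- F) inner (e i) (v x F') *: e i.
  by rewrite /v big_seq [RHS]big_seq; apply: eq_bigr => i /coef ->.
rewrite norm_fourier_rest //; congr (_ - _).
by rewrite big_seq [RHS]big_seq; apply: eq_bigr => i /coef ->.
Qed.

(** The sums of squares of Fourier coefficients are bounded, so some [F n] comes
   close to their supremum; beyond [F n] Fourier sums hardly move, by
   [fourier_gap].  Hence these sums converge, and their limit has the same
   coefficients as [x], which by maximality of the basis identifies it. *)
Lemma fourier_cvg x (eps : R) : 0 < eps ->
  \forall F \near summability.totally, `|v x F - x| <= eps%:C.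
Proof.
have [one emax] := basis_e.
pose q (F : {fset I}) : R := complex.Re (\sum_(i <- F) `|inner (e i) x| ^+ 2).
have qE (F : {fset I}) : \sum_(i <- F) `|inner (e i) x| ^+ 2 = (q F)%:C.
  by rewrite RRe_real // ger0_real // sumr_ge0 // => i _; rewrite exprn_ge0.
have qsup : has_sup (range q).
  split; first by exists (q fset0); exists fset0.
  exists (complex.Re (`|x| ^+ 2)) => _ [F _ <-].
  rewrite -lecR -qE RRe_real ?ger0_real ?exprn_ge0 //.
  exact: bessel.
(* The square lets the gap be [n.+1%:R^-1] without a square root. *)
have approx n : exists F : {fset I}, forall F' : {fset I}, (F `<=` F')%fset ->
    `|v x F' - v x F| <= (n.+1%:R^-1)%:C.
  have n0 : 0 < (n.+1%:R^-1 : R) ^+ 2 by rewrite exprn_gt0.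
  have [_ [F _ <-] Fsup] := sup_adherent n0 qsup.
  exists F => F' FF'; rewrite -(@ler_pXn2r _ 2) ?nnegrE ?lecR //.
  rewrite fourier_gap // !qE -rmorphB -rmorphXn lecR.
  rewrite lerBlDr; apply: le_trans (ub_le_sup qsup.2 (imageT q F')) _.
  by rewrite -lerBlDl ltW.
have [F Fgap] := choice approx.
pose w n := v x (F n).
have invS_le (d : R) : 0 < d -> exists N, forall n, (N <= n)%N ->
    n.+1%:R^-1 <= d.
  move=> d0; have [N _ dN] := near_infty_natSinv_lt (PosNum d0).
  by exists N => n /dN /ltW.
have [l wl] : exists l : X, forall d : R, 0 < d ->
    \forall n \near \oo, `|w n - l| <= d%:C.
  apply: hilbert_cauchy_cvg => d d0.
  have [N dN] := invS_le (d / 2) (divr_gt0 d0 (ltr0Sn _ _)).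
  exists N => n Nn; pose FU := (F n `|` F N)%fset.
  rewrite -(subrK (v x FU) (w n)) -addrA.
  apply: le_trans (ler_normD _ _) _; rewrite distrC (splitr d) rmorphD lerD //.
    by apply: le_trans (Fgap _ _ (fsubsetUl _ _)) _; rewrite lecR dN.
  by apply: le_trans (Fgap _ _ (fsubsetUr _ _)) _; rewrite lecR dN.
have xl : x = l.
  apply/eqP; rewrite -subr_eq0; apply/eqP/emax => i; apply/eqP.
  rewrite -normr_le0; apply: (@le_addepsC _ _ 0) => // d d0; rewrite add0r.
  have d20 : 0 < d / 2 by rewrite divr_gt0.
  have [N1 dN1] := invS_le _ d20; have [N2 _ dN2] := wl _ d20.
  (* Once [i] is in the index set, its coefficient is exact. *)
  pose n := (N1 + N2)%N; pose FU := (i |` F n)%fset.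
  have -> : inner (e i) (x - l) =
      inner (e i) (v x FU - w n) + inner (e i) (w n - l).
    rewrite -innerDr addrA subrK !innerBr inner_comb //.
    by rewrite in_fsetU in_fset1 eqxx.
  apply: le_trans (ler_normD _ _) _; rewrite (splitr d) rmorphD lerD //.
    apply: le_trans (cauchy_schwarz _ _) _.
    rewrite (orthonormal_norm one) mul1r.
    apply: le_trans (Fgap _ _ (fsubsetUr _ _)) _.
    by rewrite lecR dN1 // leq_addr.
  apply: le_trans (cauchy_schwarz _ _) _; rewrite (orthonormal_norm one) mul1r.
  by apply: dN2; rewrite /= leq_addl.
move=> eps0; have e20 : 0 < eps / 2 by rewrite divr_gt0.
have [N1 dN1] := invS_le _ e20; have [N2 _ dN2] := wl _ e20.
pose n := (N1 + N2)%N; exists (F n) => // F' /= FF'.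
rewrite -(subrK (w n) (v x F')) -addrA.
apply: le_trans (ler_normD _ _) _; rewrite (splitr eps) rmorphD lerD //.
  apply: le_trans (Fgap _ _ FF') _.
  by rewrite lecR dN1 // leq_addr.
by rewrite [in w n - x]xl; apply: dN2; rewrite /= leq_addl.
Qed.

End Fourier.

(** * The trace of a product *)

#[local] Existing Instance summability.totally_filter.

Section Trace.
Context {R : realType} {X Y : hilbertType R}.
Variables (s t : nat -> R).
Variables (f l : nat -> X) (g h : nat -> Y).
Variables (A : X -> Y) (T : {linear Y -> X}).
Hypotheses (hA : schmidt_form A s f g) (hT : schmidt_form T t h l).
Hypothesis cst : cvgn (series (fun n => s n * t n)).

Let tr n := \sum_(j < n) (s j)%:C * inner (f j) (T (g j)).

Let s_ge0 k : 0 <= s k. Proof. by have [[]] := hA. Qed.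
Let t_ge0 k : 0 <= t k. Proof. by have [[]] := hT. Qed.

(** The difference is itself a finite diagonal sum for [A] minus its truncation,
   taken over the vectors [g (N + i)]. *)
Lemma partial_trace_gap N k (b : R) :
  (forall n, \sum_(j < n) s (N + j)%N * t j <= b) ->
  `|tr (N + k) - tr N| <= b%:C.
Proof.
move=> stb; have hA' := schmidt_form_shift N hA.
have [_ _ _ ong _] := hA'.
have := schmidt_pairing_le ong (iota_uniq 0 k) hA' hT stb.
rewrite (_ : \sum_(i <- iota 0 k) _ = tr (N + k) - tr N) //.
rewrite /tr (sum_ord_split (fun j => (s j)%:C * inner (f j) (T (g j)))).
rewrite addrC addKr -{1}[k]subn0 big_mkord.
by apply: eq_bigr => j _; rewrite (schmidt_form_coef _ _ hA').
Qed.

Lemma partial_trace_cvg : exists tau : R[i], forall N (b : R),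
  (forall n, \sum_(j < n) s (N + j)%N * t j <= b) -> `|tau - tr N| <= b%:C.
Proof.
have [[sdecr _] slim _ _ _] := hA; have [[tdecr _] _ _ _ _] := hT.
have [tau tautr] : exists tau : R[i], forall eps : R, 0 < eps ->
    \forall n \near \oo, `|tr n - tau| <= eps%:C.
  apply: complex_cauchy_cvg => eps eps0.
  have [N _ stN] := shifted_sum_small s_ge0 sdecr slim t_ge0 tdecr cst eps0.
  exists N => n Nn; rewrite -(subnKC Nn); apply: partial_trace_gap.
  exact: (stN N (leqnn N)).
exists tau => N b stb; apply: le_addepsC => // eps eps0.
have [M _ /(_ (N + M)%N (leq_addl _ _)) trM] := tautr _ eps0.
rewrite -(subrK (tr (N + M)) tau) -addrA addrC rmorphD.
apply: le_trans (ler_normD _ _) _; apply: lerD.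
  exact: partial_trace_gap.
by rewrite distrC.
Qed.

(** For each of the finitely many [j], the diagonal sum is the value of the
   bounded functional [inner (f j) \o T] at the Fourier sum of [g j]. *)
Lemma finite_rank_trace_cvg N (I : choiceType) (e : I -> Y) :
  orthonormal_basis e -> forall eps : R, 0 < eps ->
  \forall F \near summability.totally,
    `|\sum_(i <- (F : {fset I})) inner (e i) (truncation s f g N (T (e i)))
      - tr N| <= eps%:C.
Proof.
move=> basis_e eps eps0; have [_ _ onf _ _] := hA.
pose c : R := t 0%N + 1.
have c0 : 0 < c by rewrite ltr_wpDl.
pose dl := eps / (c * (\sum_(j < N) s j + 1)).
have sum0 : 0 < \sum_(j < N) s j + 1 by rewrite ltr_wpDl // sumr_ge0.
have dl0 : 0 < dl by rewrite divr_gt0 // mulr_gt0.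
pose v y (F : {fset I}) := \sum_(i <- F) inner (e i) y *: e i.
have : \forall F \near summability.totally, forall j : 'I_N,
    `|v (g j) F - g j| <= dl%:C.
  by apply: filter_forall => j; exact: fourier_cvg.
apply: filterS => F vF.
have -> : \sum_(i <- F) inner (e i) (truncation s f g N (T (e i))) =
    \sum_(j < N) (s j)%:C * inner (f j) (T (v (g j) F)).
  under eq_bigr do rewrite inner_sumr.
  rewrite exchange_big; apply: eq_bigr => j _ /=.
  rewrite linear_sum inner_sumr mulr_sumr; apply: eq_bigr => i _.
  by rewrite linearZ /= !innerZr; ring.
rewrite -sumrB; apply: le_trans (ler_norm_sum _ _ _) _.
apply: le_trans (_ : \sum_(j < N) (s j * (c * dl))%:C <= _).
  apply: ler_sum => j _; rewrite -mulrBr -innerBr -linearB normrM rmorphM.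
  rewrite (ger0_norm (_ : 0 <= (s j)%:C)); last by rewrite lecR.
  apply: ler_wpM2l; first by rewrite lecR.
  apply: le_trans (cauchy_schwarz _ _) _; rewrite (orthonormal_norm onf) mul1r.
  apply: le_trans (schmidt_form_bound _ hT) _.
  by rewrite rmorphM; apply: ler_wpM2l (vF j); rewrite lecR ltW.
rewrite -rmorph_sum lecR -mulr_suml mulrC.
have -> : c * dl = eps / (\sum_(j < N) s j + 1).
  by rewrite /dl; field; rewrite !gt_eqF.
by rewrite mulrAC ler_pdivrMr // ler_pM2l // lerDl.
Qed.

(** The error does not involve [T] except through its singular numbers, so it is
   uniform over unitary perturbations of [T].  The partial sums over any basis
   converge because, up to the small contribution of the remainder of [A],
   they are those of a finite rank operator.  Some basis exists, so the limit is
   the only possible value of the trace. *)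
Lemma trace_approx N (b : R) :
  (forall n, \sum_(j < n) s (N + j)%N * t j <= b) ->
  `|trace (A \o T) - \sum_(j < N) (s j)%:C * inner (f j) (T (g j))| <= b%:C.
Proof.
have [[sdecr _] slim _ _ _] := hA; have [[tdecr _] _ _ _ _] := hT.
have [tau tautr] := partial_trace_cvg.
suff -> : trace (A \o T) = tau by exact: tautr.
have cvg_tau (I : choiceType) (e : I -> Y) : orthonormal_basis e ->
    summability.partial_sum (fun i => inner (e i) ((A \o T) (e i)) : R[i]^o) @
      summability.totally --> (tau : R[i]^o).
  move=> basis_e; apply/cvgrPdist_le => eps' eps'0.
  have epsE : eps' = (complex.Re eps')%:C by rewrite RRe_real ?gtr0_real.
  rewrite epsE in eps'0 *; move: (complex.Re eps') eps'0 => eps {eps' epsE}.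
  rewrite ltcR => eps0; have e30 : 0 < eps / 3 by rewrite divr_gt0.
  have [M _ /(_ M (leqnn M)) stM] :=
    shifted_sum_small s_ge0 sdecr slim t_ge0 tdecr cst e30.
  have := finite_rank_trace_cvg M basis_e e30.
  apply: filterS => F trF.
  rewrite /summability.partial_sum.
  rewrite -(big_seq_fsetE _ _ xpredT
    (fun i => inner (e i) ((A \o T) (e i)))) /=.
  have -> : tau - \sum_(i <- F) inner (e i) (A (T (e i))) =
     (tau - tr M) -
     (\sum_(i <- F) inner (e i) (truncation s f g M (T (e i))) - tr M) -
     \sum_(i <- F) inner (e i) (A (T (e i)) - truncation s f g M (T (e i))).
    under [X in _ = _ - X]eq_bigr do rewrite innerBr.
    by rewrite sumrB; ring.
  have -> : eps = eps / 3 + eps / 3 + eps / 3 by field.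
  rewrite 2!rmorphD; apply: le_trans (ler_normB _ _) _; apply: lerD.
    by apply: le_trans (ler_normB _ _) _; apply: lerD => //; exact: tautr.
  have [one _] := basis_e.
  exact: (schmidt_pairing_le one (fset_uniq F) (schmidt_form_shift M hA) hT).
apply: xget_unique => // tau' cvg_tau'.
have [I [e basis_e]] := @exists_orthonormal_basis R Y.
exact: (cvg_unique (@norm_hausdorff _ R[i]^o)
  (cvg_tau' I e basis_e) (cvg_tau I e basis_e)).
Qed.

End Trace.

(** * Maximizers of compact operators *)

(** Read [a] and [b] as the norms of the sum and difference of two vectors of
   the unit ball.  If the image of the sum under an operator of norm [sigma] is
   almost as long as possible, the sum has length almost 2, and the
   parallelogram identity makes the difference short. *)
Lemma short_difference (R : realType) (sigma d a b eps : R) :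
  0 < sigma -> 0 <= a -> 0 <= b -> 0 < eps ->
  d <= sigma / 2 -> d <= sigma * eps ^+ 2 / 16 ->
  2 * sigma - 4 * d <= sigma * a -> a ^+ 2 + b ^+ 2 <= 4 -> b <= eps.
Proof.
move=> s0 a0 b0 eps0 ds de sa ab.
have s2 : 0 < sigma ^+ 2 by rewrite exprn_gt0.
rewrite -(@ler_pXn2r _ 2) ?nnegrE ?(ltW eps0) //.
rewrite -(ler_pM2l s2).
have sd0 : 0 <= 2 * sigma - 4 * d by lra.
have : (2 * sigma - 4 * d) ^+ 2 <= (sigma * a) ^+ 2.
  by rewrite ler_pXn2r // nnegrE // mulr_ge0 // ltW.
(* Then [sigma^2 b^2 <= 4 sigma^2 - (2 sigma - 4 d)^2 <= 16 sigma d]. *)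
have : sigma ^+ 2 * (a ^+ 2 + b ^+ 2) <= sigma ^+ 2 * 4 by rewrite ler_pM2l.
have : sigma * d <= sigma * (sigma * eps ^+ 2 / 16) by rewrite ler_pM2l.
have := sqr_ge0 d.
by rewrite !expr2; nra.
Qed.

Section CompactMaximum.
Context {R : realType} {X Y : hilbertType R}.
Variables (C : {linear X -> Y}).
Hypothesis cptC : compact_operator C.

(** A cluster point of the images replaces the extraction of a subsequence. *)
Lemma compact_operator_cluster (x : nat -> X) : (forall n, `|x n| <= 1) ->
  exists p : Y, forall (eps : R) N, 0 < eps ->
    exists2 n, (N <= n)%N & rnorm (C (x n) - p) <= eps.
Proof.
move=> x1; have FC : ProperFilter ((C \o x) @ \oo) by exact: fmap_proper_filter.
have [|p [_ clp]] := cptC FC.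
  exists 0%N => // n _; apply: subset_closure.
  by exists (x n) => //=; exact: x1.
exists p => eps N eps0.
have epsC : 0 < eps%:C :> R[i] by rewrite ltcR.
have [_ [[n Nn <-] pn]] := clp ((C \o x) @` [set n | (N <= n)%N]) _
  (ltac:(by exists N => // n /= Nn; exists n))  (nbhsx_ballx p _ epsC).
exists n => //; rewrite -lecR -rnormE distrC ltW //.
by move: pn; rewrite -ball_normE.
Qed.

Lemma compact_operator_bounded : exists B : R, forall x, `|x| <= 1 ->
  rnorm (C x) <= B.
Proof.
apply: contrapT => nB.
have /choice[x xP] (n : nat) : exists x, `|x| <= 1 /\ n%:R < rnorm (C x).
  apply: contrapT => nx; apply: nB; exists n%:R => x x1.
  by rewrite leNgt; apply/negP => xn; apply: nx; exists x.
have [p pP] := compact_operator_cluster (fun n => (xP n).1).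
pose N := (Num.bound (rnorm p + 1)).
have [n Nn np] := pP 1 N ltr01.
have := (xP n).2; apply/negP; rewrite -leNgt.
rewrite -(subrK p (C (x n))); apply: le_trans (rnormD _ _) _.
apply: le_trans (_ : N%:R <= _); last by rewrite ler_nat.
apply: le_trans (_ : rnorm p + 1 <= _); first by rewrite addrC lerD2l.
by rewrite ltW // archi_boundP // addr_ge0 ?rnorm_ge0.
Qed.

Variables (u : nat -> X) (m : nat).
Let M : set X := [set x | forall i, (i < m)%N -> inner (u i) x = 0].

Lemma complement_max_le (sigma : R) :
  (forall x, M x -> `|x| <= 1 -> rnorm (C x) <= sigma) ->
  forall x, M x -> rnorm (C x) <= sigma * rnorm x.
Proof.
move=> Csigma x Mx; have [->|x0] := eqVneq x 0.
  by rewrite linear0 !rnorm0 mulr0.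
have nx0 : 0 < rnorm x by rewrite lt_def rnorm_eq0 x0 rnorm_ge0.
have reV : complex.Re `|((rnorm x)^-1)%:C| = (rnorm x)^-1.
  by rewrite ger0_norm // ler0c invr_ge0 rnorm_ge0.
have := Csigma (((rnorm x)^-1)%:C *: x).
rewrite -rnorm_le linearZ !rnormZ reV mulVf ?gt_eqF // lexx.
rewrite ler_pdivrMl // mulrC; apply=> // i im.
by rewrite innerZr Mx // mulr0.
Qed.

(** A maximizing sequence in the unit ball whose images converge is itself
   Cauchy, by [short_difference]. *)
Lemma complement_max_cauchy (sigma : R) (y : nat -> X) (p : Y) :
  0 < sigma -> (forall x, M x -> rnorm (C x) <= sigma * rnorm x) ->
  (forall n, [/\ M (y n), rnorm (y n) <= 1,
     sigma - n.+1%:R^-1 <= rnorm (C (y n)) &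
     rnorm (C (y n) - p) <= n.+1%:R^-1]) ->
  forall eps : R, 0 < eps -> exists N, forall n, (N <= n)%N ->
    `|y n - y N| <= eps%:C.
Proof.
move=> s0 Csigma yP eps eps0.
have d0 : 0 < Num.min (sigma * eps ^+ 2 / 16) (sigma / 2).
  by rewrite lt_min !divr_gt0 // mulr_gt0 // exprn_gt0.
have [N _ /(_ N (leqnn N)) dN] := near_infty_natSinv_lt (PosNum d0).
move: dN; rewrite /= lt_min => /andP[dN1 dN2].
exists N => n Nn; rewrite -rnorm_le.
have [My1 ny1 Cy1 py1] := yP n; have [My2 ny2 Cy2 py2] := yP N.
have dn : n.+1%:R^-1 <= N.+1%:R^-1 :> R by rewrite lef_pV2 ?posrE // ler_nat.
have := rnorm_parallelogram (y n) (y N).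
have Mplus : M (y n + y N) by move=> i im; rewrite innerDr My1 // My2 // addr0.
have := Csigma _ Mplus; rewrite linearD.
have : 2 * rnorm (C (y N)) <=
    rnorm (C (y n) + C (y N)) + rnorm (C (y n) - C (y N)).
  have -> : 2 * rnorm (C (y N)) = rnorm (C (y N) + C (y N)).
    apply: complexI; rewrite rmorphM rmorph_nat /= -!rnormE.
    by rewrite -mulr2n normrMn mulr_natl.
  rewrite (_ : C (y N) + C (y N) = (C (y n) + C (y N)) - (C (y n) - C (y N))).
    by apply: le_trans (rnormD _ _) _; rewrite lerD2l /rnorm normrN.
  by rewrite opprB addrACA addrC addrA addrNK.
have : rnorm (C (y n) - C (y N)) <= N.+1%:R^-1 + N.+1%:R^-1.
  rewrite -(subrK p (C (y n))) -addrA.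
  apply: le_trans (rnormD _ _) _; apply: lerD; last by rewrite rnormB.
  exact: le_trans dn.
move: (rnorm_ge0 (y n + y N)) (rnorm_ge0 (y n - y N)).
move: (rnorm_ge0 (y n)) (rnorm_ge0 (y N)) ny1 ny2 Cy1 Cy2 dN1 dN2 dn.
set b := rnorm (y n - y N); set a := rnorm (y n + y N).
set d := _^-1; set d' := _^-1; set c1 := rnorm (C _); set c2 := rnorm (C _).
set c3 := rnorm _; set c4 := rnorm _; set a1 := rnorm _; set a2 := rnorm _.
move=> c30 c40 c31 c41 c1s c2s d'1 d'2 dd a0 b0 a1d a2a1 a2s ab.
apply: (@short_difference R sigma d' a b eps) => //;
  [exact: ltW|exact: ltW|lra|].
have c32 : c3 ^+ 2 <= 1 by rewrite exprn_ile1.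
have c42 : c4 ^+ 2 <= 1 by rewrite exprn_ile1.
lra.
Qed.

(** The supremum of the norm of [C] on the unit sphere of an orthogonal
   complement is attained at the limit of a suitable maximizing sequence.  If
   the supremum is 0, any unit vector of the complement will do. *)
Lemma compact_operator_max :
  (exists x, `|x| = 1 /\ M x) ->
  exists x, [/\ `|x| = 1, M x & forall y, M y -> `|C y| <= `|C x| * `|y|].
Proof.
case=> x0 [x01 Mx0].
pose S := [set rnorm (C x) | x in [set x | M x /\ `|x| <= 1]].
have [B CB] := compact_operator_bounded.
have Ssup : has_sup S.
  split; first by exists (rnorm (C x0)), x0 => //; rewrite /= x01.
  by exists B => _ [x [_ x1] <-]; exact: CB.
pose sigma := sup S.
have Csigma : forall x, M x -> rnorm (C x) <= sigma * rnorm x.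
  apply: complement_max_le => x Mx x1.
  by apply: (ub_le_sup Ssup.2); exists x.
suff [x [x1 Mx Cx]] : exists x, [/\ `|x| = 1, M x & sigma <= rnorm (C x)].
  exists x; split=> // y My; rewrite !rnormE -rmorphM lecR.
  by apply: le_trans (Csigma y My) _; rewrite ler_wpM2r ?rnorm_ge0.
have sigma_ge0 : 0 <= sigma.
  apply: le_trans (rnorm_ge0 (C x0)) (ub_le_sup Ssup.2 _).
  by exists x0; rewrite //= x01.
move: sigma_ge0; rewrite le_eqVlt => /predU1P[<-|sigma0].
  by exists x0; split=> //; exact: rnorm_ge0.
have /choice[x xP] (n : nat) : exists x,
    [/\ M x, `|x| <= 1 & sigma - n.+1%:R^-1 < rnorm (C x)].
  have n0 : 0 < n.+1%:R^-1 :> R by rewrite invr_gt0.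
  by have [_ [x [Mx x1] <-] xs] := sup_adherent n0 Ssup; exists x.
have x_le1 n : `|x n| <= 1 by have [] := xP n.
have [p pP] := compact_operator_cluster x_le1.
have /choice[y yP] (n : nat) : exists y,
    [/\ M y, rnorm y <= 1, sigma - n.+1%:R^-1 <= rnorm (C y) &
        rnorm (C y - p) <= n.+1%:R^-1].
  have n0 : 0 < n.+1%:R^-1 :> R by rewrite invr_gt0.
  have [k nk kp] := pP _ n n0; have [Mx _ xs] := xP k.
  exists (x k); split=> //; first by rewrite rnorm_le.
  apply: le_trans (ltW xs); rewrite lerD2l lerN2.
  by rewrite lef_pV2 ?posrE // ler_nat.
have [l yl] := hilbert_cauchy_cvg (complement_max_cauchy sigma0 Csigma yP).
have Ml : M l.
  move=> i im; apply/eqP; rewrite -normr_le0.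
  apply: (@le_addepsC _ _ 0) => // eps eps0; rewrite add0r.
  have d0 : 0 < eps / (rnorm (u i) + 1).
    by rewrite divr_gt0 // ltr_wpDl // rnorm_ge0.
  have [N _ /(_ N (leqnn N)) Nl] := yl _ d0; have [My _ _ _] := yP N.
  have -> : inner (u i) l = - inner (u i) (y N - l).
    by rewrite innerBr My // sub0r opprK.
  rewrite normrN; apply: le_trans (cauchy_schwarz _ _) _.
  move: Nl; rewrite !rnormE -rmorphM !lecR => Nl.
  apply: le_trans (ler_wpM2l (rnorm_ge0 _) Nl) _.
  rewrite mulrCA ler_piMr ?(ltW eps0) // ler_pdivrMr ?mul1r ?lerDl //.
  by rewrite ltr_wpDl // rnorm_ge0.
have Cl : sigma <= rnorm (C l).
  suff gap (eps : R) : 0 < eps -> sigma <= rnorm (C l) + eps.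
    by apply/ler_addgt0Pr => eps; exact: gap.
  move=> eps0; have e20 : 0 < eps / 2 by rewrite divr_gt0.
  have es0 : 0 < eps / 2 / sigma by rewrite divr_gt0.
  have [N1 _ yN1] := yl _ es0.
  have [N2 _ yN2] := near_infty_natSinv_lt (PosNum e20).
  pose N := (N1 + N2)%N; have [My _ Cy _] := yP N.
  have {yN1} := yN1 N (leq_addr _ _); have {yN2} := yN2 N (leq_addl _ _).
  rewrite -rnorm_le /= => Ninv yNl.
  have : rnorm (C (y N)) <= rnorm (C l) + rnorm (C (y N - l)).
    by rewrite linearB -{1}(subrK (C l) (C (y N))) addrC rnormD.
  have MyNl : M (y N - l) by move=> i im; rewrite innerBr My // Ml // subrr.
  have : sigma * rnorm (y N - l) <= eps / 2.
    by rewrite mulrC -ler_pdivlMr.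
  have := Csigma _ MyNl; move: Cy Ninv.
  move: (_^-1) => d h1 h2 h3 h4 h5; lra.
exists l; split=> //; apply/rnorm_eq1/le_anti/andP; split; last first.
  by have := le_trans Cl (Csigma l Ml); rewrite ler_pMr.
apply/ler_addgt0Pr => eps eps0; have [N _ /(_ N (leqnn N))] := yl _ eps0.
rewrite -rnorm_le rnormB => Nl; have [_ yN1 _ _] := yP N.
rewrite -(subrK (y N) l) addrC; apply: le_trans (rnormD _ _) _.
exact: lerD.
Qed.

End CompactMaximum.

(** * Existence of Schmidt decompositions *)

(** Dependent choice along a predicate [Q n u v] which reads only the first [n]
   values of [u]. *)
Lemma dependent_sequence (T : Type) (t0 : T)
    (Q : nat -> (nat -> T) -> T -> Prop) :
  (forall n u u' v, (forall k, (k < n)%N -> u k = u' k) ->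
    Q n u v -> Q n u' v) ->
  (forall n u, (forall k, (k < n)%N -> Q k u (u k)) -> exists v, Q n u v) ->
  exists u, forall n, Q n u (u n).
Proof.
move=> Qloc Qex.
have /choice[st stP] (nu : nat * (nat -> T)) : exists v,
    (forall k, (k < nu.1)%N -> Q k nu.2 (nu.2 k)) -> Q nu.1 nu.2 v.
  case: nu => n u /=.
  have [/Qex[v Qv]|nQ] := pselect (forall k, (k < n)%N -> Q k u (u k)).
    by exists v.
  by exists t0 => /nQ.
pose L := fix L n :=
  if n is m.+1 then rcons (L m) (st (m, nth t0 (L m))) else [::].
have sizeL n : size (L n) = n by elim: n => //= n IHn; rewrite size_rcons IHn.
pose u n := st (n, nth t0 (L n)).
have LS n : L n.+1 = rcons (L n) (u n) by [].
have nthL n k : (k < n)%N -> nth t0 (L n) k = u k.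
  elim: n => // n IHn; rewrite ltnS leq_eqVlt LS nth_rcons sizeL.
  by case/predU1P => [->|kn]; [rewrite ltnn eqxx|rewrite kn IHn].
exists u => n; have [m] := ubnP n; elim: m n => // m IHm n nm.
apply: (Qloc _ (nth t0 (L n))) => [k kn|]; first exact: nthL.
apply: (stP (n, nth t0 (L n))) => /= k kn; rewrite nthL //.
apply: (Qloc _ u) => [j jk|]; first by rewrite nthL // (ltn_trans jk).
by apply: IHm; rewrite (leq_trans kn).
Qed.

Section InfiniteDimension.
Context {R : realType} {X : hilbertType R}.

Lemma infinite_dim_orthogonal (dimX : infinite_dimensional X) (u : nat -> X) n :
  (forall i j, (i < n)%N -> (j < n)%N -> inner (u i) (u j) = (i == j)%:R) ->
  exists x, `|x| = 1 /\ forall i, (i < n)%N -> inner (u i) x = 0.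
Proof.
move=> onu; pose e (i : 'I_n) := u i.
have one : orthonormal_system e by move=> i j; rewrite onu.
have [x xspan] : exists x, x - \sum_(i < n) inner (e i) x *: e i <> 0.
  apply: contrapT => nx; apply: dimX; exists n, e => x.
  exists (fun i => inner (e i) x); apply/eqP; rewrite -subr_eq0.
  by apply/eqP; apply: contrapT => xn; apply: nx; exists x.
pose y := x - \sum_(i < n) inner (e i) x *: e i.
have ny0 : `|y| != 0 by rewrite normr_eq0; exact/eqP.
exists (`|y|^-1 *: y); split.
  by rewrite normrZ normfV normr_id; exact: mulVf.
move=> i ni; rewrite innerZr innerBr (_ : u i = e (Ordinal ni)) //.
rewrite inner_comb ?mem_index_enum ?index_enum_uniq //.
by rewrite subrr mulr0.
Qed.

End InfiniteDimension.

Section SchmidtExistence.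
Context {R : realType} {X Y : hilbertType R}.
Variable C : {linear X -> Y}.

(** First variation: if [C x] and [C z] were not orthogonal, moving [x] slightly
   in the direction of a multiple of [z] would increase [|C x|] to first order,
   but [|x|] only to second order. *)
Lemma maximizer_orthogonal (M : X -> Prop) (x : X) :
  (forall a y z, M y -> M z -> M (y + a *: z)) ->
  `|x| = 1 -> M x -> (forall y, M y -> `|C y| <= `|C x| * `|y|) ->
  forall z, M z -> inner x z = 0 -> inner (C x) (C z) = 0.
Proof.
move=> Mlin x1 Mx Cmax z Mz xz; set w := inner (C x) (C z).
apply/eqP; rewrite -normr_le0; apply: contraT => w0.
have {w0}w0 : 0 < `|w| ^+ 2.
  by rewrite exprn_gt0 // normr_gt0; apply: contraNneq w0 => ->; rewrite normr0.
pose b := `|C x| ^+ 2 * `|z| ^+ 2.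
have b0 : 0 <= b by rewrite mulr_ge0 ?exprn_ge0.
(* Maximality at [x + a z] with [a = eps w^*] implies [2 <= eps b], which
   this choice of [eps] violates. *)
pose eps := (b + 1)^-1; have eps0 : 0 < eps by rewrite invr_gt0 ltr_wpDl.
pose a := eps * (w^*)%R.
have na : `|a| ^+ 2 = eps ^+ 2 * `|w| ^+ 2.
  by rewrite normrM norm_conjC exprMn (ger0_norm (ltW eps0)).
have aE : a = eps * (w^*)%R by []; clearbody a.
have := Cmax _ (Mlin a x z Mx Mz).
rewrite -(@ler_pXn2r _ 2) ?nnegrE ?mulr_ge0 // exprMn.
rewrite (@pythagoras _ _ x) ?innerZr ?xz ?mulr0 // x1 expr1n.
rewrite linearD linearZ /= normD_sqr !normrZ !exprMn na.
rewrite innerZr innerZl (inner_conj (C x) (C z)) -/w aE rmorphM /= conjCK.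
rewrite (CrealP (gtr0_real eps0)).
rewrite mulrDr mulr1 -addrA lerD2l => h.
have : eps * `|w| ^+ 2 * 2 <= eps * `|w| ^+ 2 * (eps * b).
  apply: le_trans (_ : eps ^+ 2 * `|w| ^+ 2 * `|C z| ^+ 2 +
     (eps * w^* * w + eps * w * w^*)%R <= _); last first.
    apply: le_trans h _; rewrite /b le_eqVlt; apply/orP; left; apply/eqP.
    by ring.
  rewrite normCK -subr_ge0.
  rewrite (_ : _ - _ = eps ^+ 2 * (w * w^*)%R * `|C z| ^+ 2); last by ring.
  by rewrite -normCK !mulr_ge0 ?exprn_ge0 // ltW.
rewrite (ler_pM2l (mulr_gt0 eps0 w0)) /eps ler_pdivlMl ?ltr_wpDl // => h2.
have : b + (b + 2) <= b + 0.
  by rewrite addr0 (_ : b + _ = (b + 1) * 2) //; ring.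
rewrite lerD2l => b2.
have b20 : 0 < b + 2 by rewrite ltr_wpDl.
by have := lt_le_trans b20 b2; rewrite ltxx.
Qed.

(** The triple [v] is the next singular number with its two singular vectors,
   the first [n] values of [u] being the triples already found.  The last clause
   says that [C] maps the complement of the vectors found, [f] included, into
   the complement of [g]; it keeps later vectors [g] orthogonal to this one. *)
Definition schmidt_step (n : nat) (u : nat -> R * X * Y) (v : R * X * Y) :
    Prop :=
  let: (s, f, g) := v in
  [/\ `|f| = 1 /\ `|g| = 1,
      forall k, (k < n)%N -> inner (u k).1.2 f = 0 /\ inner (u k).2 g = 0,
      0 <= s /\ C f = s%:C *: g,
      forall x, (forall k, (k < n)%N -> inner (u k).1.2 x = 0) ->
        `|C x| <= s%:C * `|x| &
      forall x, (forall k, (k < n)%N -> inner (u k).1.2 x = 0) ->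
        inner f x = 0 -> inner g (C x) = 0].

Lemma schmidt_step_local n (u u' : nat -> R * X * Y) v :
  (forall k, (k < n)%N -> u k = u' k) ->
  schmidt_step n u v -> schmidt_step n u' v.
Proof.
case: v => [[s f] g] uu' [n1 on sC Cs go].
have eqx x : (forall k, (k < n)%N -> inner (u' k).1.2 x = 0) ->
    forall k, (k < n)%N -> inner (u k).1.2 x = 0.
  by move=> u'x k kn; rewrite uu' // u'x.
split=> //.
- by move=> k kn; rewrite -uu' //; exact: on.
- by move=> x /eqx; exact: Cs.
- by move=> x /eqx; exact: go.
Qed.

Lemma schmidt_step_orthonormal n (u : nat -> R * X * Y) :
  (forall k, (k < n)%N -> schmidt_step k u (u k)) ->
  (forall i j, (i < n)%N -> (j < n)%N ->
     inner (u i).1.2 (u j).1.2 = (i == j)%:R) /\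
  (forall i j, (i < n)%N -> (j < n)%N -> inner (u i).2 (u j).2 = (i == j)%:R).
Proof.
move=> ustep.
have diag k : (k < n)%N ->
    inner (u k).1.2 (u k).1.2 = 1 /\ inner (u k).2 (u k).2 = 1.
  move/ustep; case: (u k) => [[s f] g] [[f1 g1] _ _ _ _] /=.
  by rewrite !inner_norm f1 g1 expr1n.
have upper i j : (i < j)%N -> (j < n)%N ->
    inner (u i).1.2 (u j).1.2 = 0 /\ inner (u i).2 (u j).2 = 0.
  by move=> ij /ustep; case: (u j) => [[s f] g] [_ /(_ i ij)].
split=> i j ni nj; have [ij|ji|<-] := ltngtP i j.
- exact: (upper i j ij nj).1.
- exact/inner_eq0C/(upper j i ji ni).1.
- exact: (diag i ni).1.
- exact: (upper i j ij nj).2.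
- exact/inner_eq0C/(upper j i ji ni).2.
- exact: (diag i ni).2.
Qed.

Hypothesis cptC : compact_operator C.
Hypotheses (dimX : infinite_dimensional X) (dimY : infinite_dimensional Y).

(** [f] is a maximizer of [C] on the complement of the previous vectors, which
   is not zero since [X] has infinite dimension, and [g] is its normalized
   image.  If [C] vanishes there, the infinite dimension of [Y] provides a unit
   vector [g] orthogonal to its predecessors. *)
Lemma schmidt_step_exists n (u : nat -> R * X * Y) :
  (forall k, (k < n)%N -> schmidt_step k u (u k)) ->
  exists v, schmidt_step n u v.
Proof.
move=> ustep; have [onf ong] := schmidt_step_orthonormal ustep.
have [f [f1 Mf Cmax]] := compact_operator_max cptC
  (infinite_dim_orthogonal dimX onf).
have imgo k x : (k < n)%N ->
    (forall i, (i < n)%N -> inner (u i).1.2 x = 0) -> inner (u k).2 (C x) = 0.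
  move=> kn Mx; move: (ustep k kn) (Mx k kn).
  case: (u k) => [[s f'] g'] [_ _ _ _ go] /= xf; apply: go => // i ik.
  by rewrite Mx // (ltn_trans ik).
pose s := rnorm (C f); have sE : `|C f| = s%:C by exact: rnormE.
have [s0|s0] := eqVneq s 0.
  have [g [g1 Mg]] := infinite_dim_orthogonal dimY ong.
  have C0 x : (forall k, (k < n)%N -> inner (u k).1.2 x = 0) -> C x = 0.
    by move=> /Cmax; rewrite sE s0 mul0r normr_le0 => /eqP.
  exists (0, f, g); split=> //.
  - by move=> k kn; rewrite Mf // Mg.
  - by rewrite C0 // scale0r.
  - by move=> x /C0 ->; rewrite normr0 mul0r.
  - by move=> x /C0 -> _; rewrite inner0r.
have sC0 : s%:C != 0 by apply: contra s0 => /eqP/complexI ->.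
exists (s, f, s%:C^-1 *: C f); split=> //.
- split=> //.
  rewrite normrZ normfV sE (ger0_norm (_ : 0 <= s%:C)) ?mulVf //.
  by rewrite ler0c rnorm_ge0.
- by move=> k kn; rewrite Mf // innerZr imgo // mulr0.
- by rewrite scalerA mulfV // scale1r rnorm_ge0.
- by move=> x Mx; rewrite -sE; exact: Cmax.
- move=> x Mx fx; rewrite innerZl (_ : inner (C f) (C x) = 0) ?mulr0 //.
  apply: (@maximizer_orthogonal _ f _ f1 Mf Cmax x Mx fx) => a y z My Mz k kn.
  by rewrite innerDr innerZr (My k kn) (Mz k kn) mulr0 addr0.
Qed.

(** The singular numbers tend to 0 because the images of the [f n] are pairwise
   orthogonal of norm [s n] and must cluster.  The remainder after [n] terms is
   [C] applied to a vector orthogonal to the first [n] vectors [f k], hence of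
   norm at most [s n]. *)
Lemma schmidt_decomposition_exists :
  exists s f g, schmidt_decomposition C s f g.
Proof.
have [u uP] := dependent_sequence (0, 0, 0) schmidt_step_local
  schmidt_step_exists.
pose s n := (u n).1.1; pose f n := (u n).1.2; pose g n := (u n).2.
have onf : orthonormal_system f.
  move=> i j; have [onf _] :=
    schmidt_step_orthonormal (fun k (_ : (k < (maxn i j).+1)%N) => uP k).
  by apply: onf; rewrite ltnS (leq_maxl, leq_maxr).
have ong : orthonormal_system g.
  move=> i j; have [_ ong] :=
    schmidt_step_orthonormal (fun k (_ : (k < (maxn i j).+1)%N) => uP k).
  by apply: ong; rewrite ltnS (leq_maxl, leq_maxr).
have sC n : 0 <= s n /\ C (f n) = (s n)%:C *: g n.
  by have := uP n; rewrite /s /f /g; case: (u n) => [[? ?] ?] [].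
have Cs n x : (forall k, (k < n)%N -> inner (f k) x = 0) ->
    `|C x| <= (s n)%:C * `|x|.
  by have := uP n; rewrite /s; case: (u n) => [[? ?] ?] [_ _ _ h _] /h.
have s_ge0 n : 0 <= s n by have [] := sC n.
have nCf n : rnorm (C (f n)) = s n.
  apply: complexI; rewrite -rnormE (sC n).2 normrZ orthonormal_norm // mulr1.
  by rewrite ger0_norm // ler0c.
have sdecr : nonincreasing_seq s.
  apply/nonincreasing_seqP => n; rewrite -(nCf n.+1) rnorm_le.
  rewrite -[(s n)%:C]mulr1 -(orthonormal_norm onf n.+1); apply: Cs => k kn.
  by rewrite onf; case: eqP => // kE; rewrite kE ltnNge leqnSn in kn.
have s_small (eps : R) : 0 < eps -> exists n, s n < eps.
  move=> eps0; apply: contrapT => ns.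
  have sge n : eps <= s n.
    by rewrite leNgt; apply/negP => sn; apply: ns; exists n.
  have [|p pP] := @compact_operator_cluster _ _ _ C cptC f.
    by move=> n; rewrite orthonormal_norm.
  have e20 : 0 < eps / 2 by rewrite divr_gt0.
  have [i _ ip] := pP _ 0%N e20; have [j ij jp] := pP _ i.+1 e20.
  have Cij : rnorm (C (f i) - C (f j)) <= eps.
    rewrite -(subrK p (C (f i))) -addrA (splitr eps).
    by apply: le_trans (rnormD _ _) _; rewrite lerD // rnormB.
  have : rnorm (C (f i) - C (f j)) ^+ 2 = s i ^+ 2 + s j ^+ 2.
    rewrite -!nCf; apply: complexI; rewrite rmorphD !rmorphXn /= -!rnormE.
    rewrite normB_sqr !(sC _).2 !innerZl !innerZr !ong.
    rewrite eqn_leq [(j <= i)%N]leqNgt ij andbF eqn_leq leqNgt ij /=.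
    by rewrite !mulr0 addr0 subr0.
  have := sge i; have := sge j; have := rnorm_ge0 (C (f i) - C (f j)).
  move: Cij; move: (rnorm _) (s i) (s j) => a b c; clear -eps0; nra.
exists s, f, g; split=> //.
- apply/cvgrPdist_le => eps eps0; have [N sN] := s_small _ eps0.
  exists N => // n /= Nn; rewrite sub0r normrN ger0_norm //.
  exact: le_trans (sdecr _ _ Nn) (ltW sN).
- move=> eps eps0; have [N sN] := s_small _ eps0.
  exists N => // n /= Nn x.
  pose y := \sum_(k < n) inner (f k) x *: f k.
  have -> : \sum_(k < n) ((s k)%:C * inner (f k) x) *: g k = C y.
    rewrite linear_sum; apply: eq_bigr => k _.
    by rewrite linearZ /= (sC k).2 scalerA mulrC.
  have yE : y = \sum_(k <- iota 0 n) inner (f k) x *: f k.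
    rewrite /y -(big_mkord xpredT (fun k => inner (f k) x *: f k)).
    by rewrite /index_iota subn0.
  have yx : `|x - y| <= `|x|.
    rewrite -(@ler_pXn2r _ 2) ?nnegrE // yE norm_fourier_rest ?iota_uniq //.
    by rewrite lerBlDr lerDl sumr_ge0 // => k _; rewrite exprn_ge0.
  rewrite -linearB; apply: le_trans (Cs n _ _) _.
    move=> k kn; rewrite innerBr yE inner_comb ?iota_uniq ?subrr //.
    by rewrite mem_iota.
  apply: ler_pM => //; rewrite lecR //.
  exact: le_trans (sdecr _ _ Nn) (ltW sN).
Qed.

End SchmidtExistence.

(** * Unitary operators *)

Section Unitary.
Context {R : realType} {X : hilbertType R}.

(** For a suitable scalar [a] this is the unitary operator that multiplies [w]
   by a phase and fixes its orthogonal complement. *)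
Definition reflection (a : R[i]) (w z : X) : X := z - (a * inner w z) *: w.

Lemma reflection_is_linear a w : linear (reflection a w).
Proof.
move=> c x y; rewrite /reflection innerDr innerZr scalerBr addrACA -opprD.
by congr (_ - _); rewrite scalerA -scalerDl; congr (_ *: _); ring.
Qed.

HB.instance Definition _ a w :=
  GRing.isLinear.Build R[i] X X *:%R (reflection a w)
    (reflection_is_linear a w).

Lemma reflection_unitary (a : R[i]) (w : X) :
  (a + a^* = a * a^* * `|w| ^+ 2)%R -> unitary X (reflection a w).
Proof.
move=> aw; split.
  move=> z _; exists (reflection (a^*)%R w z) => //.
  rewrite /= /reflection innerBr innerZr inner_norm mulrBr.
  rewrite -addrA -opprD -scalerDl.
  rewrite [X in X *: w](_ : _ = 0) ?scale0r ?subr0 //.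
  transitivity (inner w z * ((a + a^*)%R - (a * a^* * `|w| ^+ 2)%R)).
    by ring.
  by rewrite aw subrr mulr0.
move=> x y; rewrite /= /reflection innerBl !innerBr !innerZl !innerZr.
rewrite inner_norm rmorphM /= -(inner_conj w x).
apply/eqP; rewrite -subr_eq0; apply/eqP.
transitivity (- (inner x w * inner w y) *
  ((a + a^*)%R - (a * a^* * `|w| ^+ 2)%R)); first by ring.
by rewrite aw subrr mulr0.
Qed.

Lemma unitary_comp (U V : {linear X -> X}) :
  unitary X U -> unitary X V -> unitary X (U \o V).
Proof.
move=> [surjU innU] [surjV innV]; split=> [z _|x y]; last first.
  by rewrite /= innU innV.
have [y _ <-] := surjU z I; have [x _ <-] := surjV y I.
by exists x.
Qed.

Lemma unitary_id : unitary X idfun.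
Proof. by split=> // z _; exists z. Qed.

Lemma unitary_norm (U : {linear X -> X}) x : unitary X U -> `|U x| = `|x|.
Proof.
case=> _ innU; apply/eqP; rewrite -(@eqrXn2 _ 2) //.
by rewrite -!inner_norm innU.
Qed.

(** Reflect along [x - y].  The coefficient that sends [x] to [y] is the inverse
   of [u = inner (x - y) x]; it satisfies the condition of unitarity because
   [|x - y| ^+ 2] is the sum of [u] and its conjugate. *)
Lemma unitary_move (x y : X) : `|x| = 1 -> `|y| = 1 ->
  exists U : {linear X -> X}, [/\ unitary X U, U x = y &
    forall z, inner x z = 0 -> inner y z = 0 -> U z = z].
Proof.
move=> x1 y1; have [->|xy] := eqVneq x y.
  by exists idfun; split=> //; exact: unitary_id.
pose w := x - y; pose u := inner w x.
have xx : inner x x = 1 by rewrite inner_norm x1 expr1n.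
have yy : inner y y = 1 by rewrite inner_norm y1 expr1n.
have uJ : inner w y = - (u^*)%R.
  by rewrite /u /w !innerBl rmorphB /= -!inner_conj xx yy opprB.
have w2 : `|w| ^+ 2 = (u + u^*)%R.
  by rewrite -inner_norm {2}/w innerBr uJ opprK.
have u0 : u != 0.
  apply: contra xy => /eqP u0; rewrite -subr_eq0 -normr_eq0 -sqrf_eq0.
  by rewrite w2 u0 conjC0 addr0.
have uC0 : (u^*)%R != 0 by rewrite conjC_eq0.
exists (reflection u^-1 w); split.
- apply: reflection_unitary; rewrite w2 fmorphV /=; field.
  by rewrite u0 uC0.
- by rewrite /= /reflection -/u mulVf // scale1r opprB addrC subrK.
- move=> z xz yz; rewrite /= /reflection.
  by rewrite (_ : inner w z = 0) ?mulr0 ?scale0r ?subr0 // innerBl xz yz subrr.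
Qed.

(** By induction on [n]: move the image of [a n] to [b n] by an operator that
   fixes the previous vectors, which are orthogonal to both. *)
Lemma unitary_extension (a b : nat -> X) n :
  (forall i j, (i < n)%N -> (j < n)%N -> inner (a i) (a j) = (i == j)%:R) ->
  (forall i j, (i < n)%N -> (j < n)%N -> inner (b i) (b j) = (i == j)%:R) ->
  exists2 U : {linear X -> X}, unitary X U &
    forall k, (k < n)%N -> U (a k) = b k.
Proof.
elim: n => [|n IHn] ona onb; first by exists idfun => //; exact: unitary_id.
have [||U unU Ua] := IHn.
- by move=> i j ni nj; apply: ona; exact: leqW.
- by move=> i j ni nj; apply: onb; exact: leqW.
have norm1 (e : nat -> X) : inner (e n) (e n) = (n == n)%:R -> `|e n| = 1.
  by rewrite eqxx inner_norm => /eqP; rewrite sqrp_eq1 // => /eqP.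
have Uan : `|U (a n)| = 1 by rewrite unitary_norm // norm1 // ona.
have bn : `|b n| = 1 by rewrite norm1 // onb.
have [W [unW Wab Wfix]] := unitary_move Uan bn.
exists (W \o U); first exact: unitary_comp.
move=> k; rewrite ltnS leq_eqVlt => /predU1P[->|kn] /=; first by [].
rewrite Ua // Wfix //; last first.
  by rewrite (onb n k (leqnn _) (ltnW kn)) gtn_eqF.
by rewrite -(Ua k) // unU.2 (ona n k (leqnn _) (ltnW kn)) gtn_eqF.
Qed.

End Unitary.

Section UnitaryPerturbation.
Context {R : realType} {X Y : hilbertType R}.

(** The new right singular vectors are the preimages of the [h k] under [V],
   that is, their images under the adjoint of [V]. *)
Lemma schmidt_form_unitary (T : Y -> X) (U : {linear X -> X})
    (V : {linear Y -> Y}) t h l : unitary X U -> unitary Y V ->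
  schmidt_form T t h l ->
  exists h', schmidt_form (U \o T \o V) t h' (U \o l).
Proof.
move=> unU unV [tdecr tlim onh onl Tlim].
have /choice[h' Vh'] k : exists y, V y = h k.
  by have [y _ <-] := unV.1 (h k) I; exists y.
exists h'; split=> //.
- by move=> i j; rewrite -onh -!Vh' unV.2.
- by move=> i j; rewrite /= unU.2 onl.
move=> eps eps0; have := Tlim eps eps0; apply: filterS => n Tn y.
have -> : truncation t h' (U \o l) n y = U (truncation t h l n (V y)).
  rewrite linear_sum; apply: eq_bigr => k _.
  by rewrite linearZ /= -Vh' unV.2.
by rewrite /= -linearB unitary_norm // -(unitary_norm y unV).
Qed.

Lemma schmidt_form_singular_vector (T : Y -> X) t h l j :
  schmidt_form T t h l -> T (h j) = (t j)%:C *: l j.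
Proof.
case=> _ _ onh onl Tlim; apply/eqP; rewrite -subr_eq0 -normr_le0.
apply: (@le_addepsC _ _ 0) => // eps eps0; rewrite add0r.
have [N _ /(_ (N + j.+1)%N (leq_addr _ _) (h j))] := Tlim _ eps0.
rewrite (orthonormal_norm onh) mulr1.
rewrite (_ : truncation _ _ _ _ _ = (t j)%:C *: l j) //.
have jN : (j < N + j.+1)%N by rewrite addnS ltnS leq_addl.
rewrite /truncation (bigD1 (Ordinal jN)) //= onh eqxx mulr1.
rewrite big1 ?addr0 // => k kj.
by rewrite onh (_ : (_ == j) = false) ?mulr0 ?scale0r //; exact/negbTE.
Qed.

Variables (s t : nat -> R) (f l : nat -> X) (g h : nat -> Y).
Variables (C : {linear X -> Y}) (T : {linear Y -> X}).
Hypotheses (hC : schmidt_form C s f g) (hT : schmidt_form T t h l).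
Hypothesis cst : cvgn (series (fun n => s n * t n)).
Let r := limn (series (fun n => s n * t n)).

Lemma schmidt_form_mul_ge0 n : 0 <= s n * t n.
Proof.
have [[_ s0] _ _ _ _] := hC; have [[_ t0] _ _ _ _] := hT.
by rewrite mulr_ge0.
Qed.

Lemma trace_unitary_approx (U : {linear X -> X}) (V : {linear Y -> Y}) N b :
  unitary X U -> unitary Y V ->
  (forall n, \sum_(j < n) s (N + j)%N * t j <= b) ->
  `|trace (C \o U \o T \o V) -
    \sum_(j < N) (s j)%:C * inner (f j) (U (T (V (g j))))| <= b%:C.
Proof.
move=> unU unV; have [h' hT'] := schmidt_form_unitary unU unV hT.
exact: (@trace_approx _ _ _ s t f (U \o l) g h' C (U \o T \o V) hC hT' cst).
Qed.

Lemma trace_unitary_le (U : {linear X -> X}) (V : {linear Y -> Y}) :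
  unitary X U -> unitary Y V -> `|trace (C \o U \o T \o V)| <= r%:C.
Proof.
move=> unU unV; have := @trace_unitary_approx U V 0 r unU unV.
rewrite big_ord0 subr0; apply=> n.
exact: sum_le_lim_series schmidt_form_mul_ge0 cst.
Qed.

(** On the first [N] vectors, [V] aligns [g j] with [h j], and [U] sends [l j]
   to a unit vector whose component along [f j] is [c] and whose remainder is
   hidden in the direction of [f (N + j)], which the partial sum up to [N] does
   not see. *)
Lemma trace_unitary_dense (c : R[i]) (eps : R) : `|c| <= 1 -> 0 < eps ->
  exists (U : {linear X -> X}) (V : {linear Y -> Y}),
    [/\ unitary X U, unitary Y V &
        `|trace (C \o U \o T \o V) - c * r%:C| <= eps%:C].
Proof.
move=> c1 eps0; have e20 : 0 < eps / 2 by rewrite divr_gt0.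
have [[sdecr s0] slim onf ong _] := hC; have [[tdecr t0] _ onh onl _] := hT.
have [N [stN sumN]] : exists N,
    (forall n, \sum_(j < n) s (N + j)%N * t j <= eps / 2) /\
    `|r - \sum_(j < N) s j * t j| <= eps / 2.
  have [N1 _ stN1] := shifted_sum_small s0 sdecr slim t0 tdecr cst e20.
  have /cvgrPdist_le/(_ _ e20)[N2 _ rN2] := cst.
  exists (N1 + N2)%N; split; first by apply: stN1; rewrite /= leq_addr.
  have := rN2 (N1 + N2)%N (leq_addl _ _).
  by rewrite /series /= big_mkord.
pose d := sqrtC (1 - `|c| ^+ 2).
have c2 : 0 <= 1 - `|c| ^+ 2 by rewrite subr_ge0 exprn_ile1.
have dd : (d^* * d)%R = 1 - `|c| ^+ 2.
  by rewrite (CrealP _) ?ger0_real ?sqrtC_ge0 // -expr2 sqrtCK.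
have [U unU Ul] : exists2 U : {linear X -> X}, unitary X U &
    forall k, (k < N)%N -> U (l k) = c *: f k + d *: f (N + k)%N.
  apply: unitary_extension => i j iN jN; first exact: onl.
  rewrite innerDl !innerDr !innerZl !innerZr !onf eqn_add2l.
  rewrite (ltn_eqF (leq_trans iN (leq_addr _ _))).
  rewrite (gtn_eqF (leq_trans jN (leq_addr _ _))) !mulr0 addr0 add0r.
  rewrite !mulrA -mulrDl dd (mulrC (c^*)%R) -normCK addrC subrK mul1r.
  by [].
have [V unV Vg] : exists2 V : {linear Y -> Y}, unitary Y V &
    forall k, (k < N)%N -> V (g k) = h k.
  by apply: unitary_extension => i j _ _; [exact: ong|exact: onh].
exists U, V; split=> //.
have := trace_unitary_approx unU unV stN.
have -> : \sum_(j < N) (s j)%:C * inner (f j) (U (T (V (g j)))) =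
    c * (\sum_(j < N) s j * t j)%:C.
  rewrite rmorph_sum mulr_sumr; apply: eq_bigr => j _.
  rewrite Vg // (schmidt_form_singular_vector j hT) linearZ /= Ul //.
  rewrite innerZr innerDr !innerZr !onf eqxx.
  rewrite (ltn_eqF (leq_trans (ltn_ord j) (leq_addr _ _))).
  by rewrite mulr1 mulr0 addr0 rmorphM /=; ring.
move=> trN; set z := trace _ in trN *.
rewrite -(subrK (c * (\sum_(j < N) s j * t j)%:C) z) -addrA.
apply: le_trans (ler_normD _ _) _; rewrite (splitr eps) rmorphD lerD //.
rewrite -mulrBr normrM -rmorphB /=.
have normC_real (a : R) : `|a%:C| = `|a|%:C.
  by rewrite normc_def /= expr0n addr0 sqrtr_sqr.
rewrite normC_real distrC; apply: le_trans (ler_wpM2r _ c1) _.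
  by rewrite ler0c.
by rewrite mul1r lecR.
Qed.

End UnitaryPerturbation.

(** * Products of Schatten class operators *)

Lemma singular_numbersP (R : realType) (X Y : hilbertType R)
    (C : {linear X -> Y}) :
  infinite_dimensional X -> infinite_dimensional Y -> compact_operator C ->
  exists f g, schmidt_form C (singular_numbers C) f g.
Proof.
move=> dimX dimY cptC.
exact: (xgetPex (fun=> 0) (schmidt_decomposition_exists cptC dimX dimY)).
Qed.

(** Either both exponents are finite, or one of them is 1 and the other is
   infinite. *)
Lemma schatten_is_cvg_series (R : realType) (X Y : hilbertType R)
    (p q : \bar R) (C : {linear X -> Y}) (T : {linear Y -> X}) :
  (1 <= p)%E -> (1 <= q)%E -> (p^-1 + q^-1 = 1)%E ->
  schatten_class p C -> schatten_class q T ->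
  nonincreasing_seq (singular_numbers C) ->
  (forall n, 0 <= singular_numbers C n) ->
  nonincreasing_seq (singular_numbers T) ->
  (forall n, 0 <= singular_numbers T n) ->
  cvgn (series (fun j => singular_numbers C j * singular_numbers T j)).
Proof.
move=> p1 q1 pq [_ sp] [_ tq] sdecr s0 tdecr t0.
have powR1 (u : nat -> R) : (forall n, 0 <= u n) -> (fun n => u n `^ 1) = u.
  by move=> u0; apply/funext => n; rewrite powRr1.
case: p p1 pq sp => [p| |] //; case: q q1 tq => [q| |] //.
- rewrite !lee_fin => q1 tq p1 pq sp.
  have p0 : 0 < p by exact: lt_le_trans p1.
  have q0 : 0 < q by exact: lt_le_trans q1.
  apply: is_cvg_series_conjugate sp tq => //.
  by move: pq; rewrite !inver !gt_eqF // -EFinD => -[].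
- move=> _ _ p1; rewrite invey adde0 => /eqP; rewrite inve_eq1 => /eqP[->].
  rewrite powR1 // => sp.
  exact: is_cvg_series_mul_decreasing.
- move=> q1 tq _; rewrite invey add0e => /eqP; rewrite inve_eq1 => /eqP[q1'] _.
  rewrite q1' powR1 // in tq.
  rewrite (_ : (fun j => _) =
    (fun j => singular_numbers T j * singular_numbers C j)).
    exact: is_cvg_series_mul_decreasing.
  by apply/funext => j; rewrite mulrC.
- by move=> _ _ _; rewrite invey adde0 => /eqP; rewrite eq_sym onee_eq0.
Qed.

Theorem theorem3p2 (R : realType) (X Y : hilbertType R)
    (dimX : infinite_dimensional X) (dimY : infinite_dimensional Y)
    (p q : \bar R) (p1 : (1 <= p)%E) (q1 : (1 <= q)%E)
    (pq : (p^-1 + q^-1 = 1)%E)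
    (C : {linear X -> Y}) (T : {linear Y -> X})
    (hC : schatten_class p C) (hT : schatten_class q T) :
  let sum_n := series (fun j => singular_numbers C j * singular_numbers T j) in
  let r := limn sum_n in
  [/\ cvgn sum_n,
      ereal_sup [set (Normc.normc (trace (C \o U \o T \o V)))%:E
                | U in unitary X & V in unitary Y] = r%:E
    & closure (S_set C T) = closed_disk r].
Proof.
move=> sum_n r.
have [f [g sC]] := singular_numbersP dimX dimY hC.1.
have [h [l sT]] := singular_numbersP dimY dimX hT.1.
have [[sdecr s0] _ _ _ _] := sC; have [[tdecr t0] _ _ _ _] := sT.
have cst : cvgn sum_n by exact: schatten_is_cvg_series hC hT _ _ _ _.
have r0 : 0 <= r.
  have := sum_le_lim_series 0 (schmidt_form_mul_ge0 sC sT) cst.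
  by rewrite big_ord0.
split=> //.
- apply/eqP; rewrite eq_le; apply/andP; split.
    apply: ge_ereal_sup => _ [U unU [V unV <-]].
    by rewrite lee_fin -lecR; exact: (trace_unitary_le sC sT cst unU unV).
  apply/lee_addgt0Pr => eps eps0.
  have [|U [V [unU unV trUV]]] := trace_unitary_dense sC sT cst (c := 1) _ eps0.
    by rewrite normr1.
  set z := trace _ in trUV.
  apply: (@le_trans _ _ ((Normc.normc z)%:E + eps%:E)%E).
    rewrite -EFinD lee_fin -lecR rmorphD /=.
    have rE : r%:C = `|z + (r%:C - z)| by rewrite addrC subrK ger0_norm ?ler0c.
    rewrite rE; apply: le_trans (ler_normD _ _) _; apply: lerD => //.
    by rewrite distrC -[r%:C]mul1r.
  apply: leeD => //; apply: ereal_sup_ubound.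
  by exists U => //; exists V.
apply/seteqP; split=> z /=.
- move=> clz; apply: le_addepsC => // eps eps0.
  have epsC : 0 < eps%:C :> R[i] by rewrite ltcR.
  have [_ [[U unU [V unV <-]] zUV]] := clz _ (nbhsx_ballx (z : R[i]^o) _ epsC).
  rewrite -(subrK (trace (C \o U \o T \o V)) z) (addrC r) rmorphD.
  apply: le_trans (ler_normD _ _) _; apply: lerD; first exact: ltW.
  exact: (trace_unitary_le sC sT cst unU unV).
- move=> zr B /nbhs_ballP[e /= e0 eB].
  have eE : e = (complex.Re e)%:C by rewrite RRe_real ?gtr0_real.
  have e20 : 0 < complex.Re e / 2 by rewrite divr_gt0 // -ltcR -eE.
  have [c c1 cz] : exists2 c : R[i], `|c| <= 1 & c * r%:C = z.
    have [rE|rn0] := eqVneq r 0.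
      exists 0; first by rewrite normr0.
      move: zr; rewrite /closed_disk /= rE normr_le0 => /eqP ->.
      by rewrite mulr0.
    have rC0 : 0 < r%:C :> R[i] by rewrite ltcR lt_def rn0.
    exists (z / r%:C); last by rewrite divfK // gt_eqF.
    rewrite normrM normfV (ger0_norm (ltW rC0)) ler_pdivrMr // mul1r.
    exact: zr.
  have [U [V [unU unV trUV]]] := trace_unitary_dense sC sT cst c1 e20.
  exists (trace (C \o U \o T \o V)); split; first by exists U => //; exists V.
  apply: eB; rewrite -ball_normE /= distrC -cz.
  apply: le_lt_trans trUV _; rewrite {2}eE ltcR.
  by rewrite ltr_pdivrMr // ltr_pMr ?ltr1n // -ltcR -eE.
Qed.
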